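(* Let $M$ be a smooth manifold, $\tau\colon E\to M$ a smooth vector bundle and $\pi\colon E^*\to M$ its dual bundle. (1) For every pseudo-Lie algebroid structure on $E$, with bracket $[\,,\,]$ and left and right anchors $\alpha_l,\alpha_r\colon E\to TM$, there is a unique linear 2-contravariant tensor field $\Lambda$ on the manifold $E^*$ such that $$\iota_{E^*}[X,Y]=\{\iota_{E^*}X,\iota_{E^*}Y\}_\Lambda ,$$ $$\pi^*(\alpha_l(X)(f))=\{\iota_{E^*}X,\pi^*f\}_\Lambda,\qquad \pi^*(\alpha_r(X)(f))=-\{\pi^*f,\iota_{E^*}X\}_\Lambda$$ for all $X,Y\in\Gamma(M,E)$ and $f\in C^\infty(M)$. (2) Conversely, every linear 2-contravariant tensor field $\Lambda$ on $E^*$ defines a pseudo-Lie algebroid structure on $E$ by these formulae. (3) The pseudo-Lie algebroid structure on $E$ is a pre-Lie algebroid structure (respectively, a Lie algebroid structure) if and only if the corresponding tensor $\Lambda$ is skew-symmetric (respectively, a Poisson tensor).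
   Context: A pseudo-Lie algebroid structure on $E$ is an $\mathbb R$-bilinear bracket $[\,,\,]$ on $\Gamma(M,E)$ together with vector bundle morphisms $\alpha_l,\alpha_r\colon E\to TM$ (over the identity of $M$) such that $$[fX,gY]=f\,\alpha_l(X)(g)\,Y-g\,\alpha_r(Y)(f)\,X+fg[X,Y]$$ for all $X,Y\in\Gamma(M,E)$, $f,g\in C^\infty(M)$. It is a pre-Lie algebroid if the bracket is skew-symmetric (then $\alpha_l=\alpha_r$), and a Lie algebroid if in addition the bracket satisfies the Jacobi identity. For $X\in\Gamma(M,E)$, $\iota_{E^*}X$ is the fibrewise linear function on $E^*$ given by $\iota_{E^*}X(a)=\langle X(\pi(a)),a\rangle$. A 2-contravariant tensor field $\Lambda$ on $E^*$ (a section of $TE^*\otimes_{E^*}TE^*$) defines the bracket $\{f,g\}_\Lambda=\Lambda(df,dg)$ of functions on $E^*$. It is called linear if for all $X,Y\in\Gamma(M,E)$ the function $\Lambda(d\iota_{E^*}X,d\iota_{E^*}Y)$ is linear on the fibres of $E^*$. A Poisson tensor is a skew-symmetric $\Lambda$ for which $\{\,,\,\}_\Lambda$ satisfies the Jacobi identity.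
   Formalization: The vector bundle E is assumed to have positive rank; for rank 0 over a base of positive dimension every 2-contravariant tensor on E* = M is linear and satisfies the formulae, so uniqueness in (1) and the equivalences in (3) fail. *)

(* Defs.v *)
From HB Require Import structures.
From mathcomp Require Import all_boot all_order all_algebra.
From mathcomp Require Import all_classical all_reals all_analysis.
Set Implicit Arguments.
Unset Strict Implicit.
Unset Printing Implicit Defensive.
Import Order.TTheory GRing.Theory Num.Theory.
Import numFieldNormedType.Exports.
Local Open Scope classical_set_scope.
Local Open Scope ring_scope.

Section Smooth.
Context {R : realType}.

(* On an open set U of a finite-dimensional V this is the class C^k: the
   directional derivatives x |-> 'd f x v being C^(k-1) for every fixed v. *)
Fixpoint Cn {V W : normedModType R} (k : nat) (U : set V) (f : V -> W) : Prop :=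
  if k is k'.+1 then
    (forall x, U x -> differentiable f x) /\
    (forall v, Cn k' U (fun x => 'd f x v))
  else forall x, U x -> {for x, continuous f}.

Definition smooth {V W : normedModType R} (U : set V) (f : V -> W) : Prop :=
  forall k, Cn k U f.

Lemma near_diff (V W : normedModType R) (f g : V -> W) (x : V) :
  (\near x, f x = g x) -> differentiable f x ->
  differentiable g x /\ ('d g x = 'd f x :> (V -> W)).
Proof.
move=> fg df.
have gE : g \o shift x = cst (g x) + 'd f x +o_ 0 id.
  have /diff_locally/eqaddoP fE := df.
  apply/eqaddoP => e e0; have {}fE := fE e e0.
  have fg0 : \forall h \near (0 : V), f (h + x) = g (h + x).
    by move: fg; rewrite (near_shift 0) /= subr0; apply: filterS.
  have fgx : f x = g x by apply: nbhs_singleton fg.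
  near=> h.
  have E : f (h + x) = g (h + x) by near: h; exact: fg0.
  suff : `|(f \o shift x - (cst (f x) + 'd f x)) h| <= e * `|id h|.
    by rewrite !fctE /= E fgx.
  by near: h.
have gd := diff_unique (diff_continuous df) gE.
split=> //; apply/diff_locallyP; rewrite gd; split=> //.
exact: diff_continuous.
Unshelve. all: by end_near. Qed.

Section Rules.
Variables (V : normedModType R) (U : set V).
Hypothesis oU : open U.

Lemma Cn_ext (W : normedModType R) k (f g : V -> W) :
  (forall x, U x -> f x = g x) -> Cn k U f -> Cn k U g.
Proof.
elim: k f g => [|k IH] f g fg /=.
  move=> cf x Ux.
  have fgx : \near x, f x = g x.
    by apply: filterS (open_nbhs_nbhs (conj oU Ux)) => y /fg.
  rewrite /prop_for /continuous_at -(fg x Ux); apply: cvg_trans (cf x Ux).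
  exact: near_eq_cvg.
have dE x : U x -> differentiable f x ->
    differentiable g x /\ ('d g x = 'd f x :> (V -> W)).
  move=> Ux; apply: near_diff.
  by apply: filterS (open_nbhs_nbhs (conj oU Ux)) => y /fg.
move=> [df dfk]; split=> [x Ux|v]; first by have [] := dE x Ux (df x Ux).
by apply: IH (dfk v) => x Ux; have [_ ->] := dE x Ux (df x Ux).
Qed.

Lemma Cn_sub (W : normedModType R) k (U' : set V) (f : V -> W) :
  U `<=` U' -> Cn k U' f -> Cn k U f.
Proof.
move=> UU'; elim: k f => [|k IH] f /=; first by move=> cf x /UU'; exact: cf.
by move=> [df dfk]; split=> [x /UU'|v]; [exact: df|exact: IH].
Qed.

Lemma Cn_pred (W : normedModType R) k (f : V -> W) : Cn k.+1 U f -> Cn k U f.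
Proof.
elim: k f => [|k IH] f.
  by move=> [df _] x Ux; apply: differentiable_continuous; exact: df.
by move=> [df dfk]; split=> // v; apply: IH; exact: dfk.
Qed.

Lemma Cn_cst (W : normedModType R) k (a : W) : Cn k U (fun=> a).
Proof.
elim: k a => [|k IH] a; first by move=> x _; exact: cst_continuous.
split=> [x _|v]; first exact: differentiable_cst.
by apply: Cn_ext (IH 0) => x Ux; rewrite diff_cst.
Qed.

Lemma Cn_id k : Cn k U (fun x : V => x).
Proof.
case: k => [|k]; first by move=> x _; exact: cvg_id.
split=> [x _|v]; first exact: ex_diff.
apply: Cn_ext (Cn_cst k v) => x _; symmetry.
exact: (congr1 (fun h : V -> V => h v) (@diff_val _ _ _ _ _ _ _ (is_diff_id x))).
Qed.

Lemma CnD (W : normedModType R) k (f g : V -> W) :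
  Cn k U f -> Cn k U g -> Cn k U (fun x => f x + g x).
Proof.
elim: k f g => [|k IH] f g.
  by move=> cf cg x Ux; apply: continuousD; [exact: cf|exact: cg].
move=> [df dfk] [dg dgk]; split=> [x Ux|v].
  by apply: differentiableD; [exact: df|exact: dg].
apply: Cn_ext (IH _ _ (dfk v) (dgk v)) => x Ux.
by symmetry; exact: (congr1 (fun h => h v) (diffD (df x Ux) (dg x Ux))).
Qed.

Lemma Cn_sum (W : normedModType R) k n (f : 'I_n -> V -> W) :
  (forall i, Cn k U (f i)) -> Cn k U (fun x => \sum_i f i x).
Proof.
elim: n f => [|n IH] f fk.
  by apply: Cn_ext (Cn_cst k 0) => x _; rewrite big_ord0.
apply: (@Cn_ext _ _ (fun x => f ord0 x + \sum_i f (lift ord0 i) x)).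
  by move=> x _; rewrite big_ord_recl.
by apply: CnD => //; exact: IH.
Qed.

Lemma CnM k (f g : V -> R^o) :
  Cn k U f -> Cn k U g -> Cn k U (fun x => f x * g x : R^o).
Proof.
elim: k f g => [|k IH] f g.
  by move=> cf cg x Ux; apply: continuousM; [exact: cf|exact: cg].
move=> fk gk; have [df dfk] := fk; have [dg dgk] := gk; split=> [x Ux|v].
  by apply: differentiableM; [exact: df|exact: dg].
apply: Cn_ext (CnD (IH _ _ (Cn_pred fk) (dgk v)) (IH _ _ (Cn_pred gk) (dfk v))).
move=> x Ux; symmetry.
exact: (congr1 (fun h => h v) (diffM (df x Ux) (dg x Ux))).
Qed.

Lemma Cn_lin (W W' : normedModType R) k (L : {linear W -> W'}) (f : V -> W) :
  continuous L -> Cn k U f -> Cn k U (fun x => L (f x)).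
Proof.
move=> cL; elim: k f => [|k IH] f.
  by move=> cf x Ux; apply: continuous_comp; [exact: cf|exact: cL].
move=> [df dfk]; split=> [x Ux|v].
  apply: (@differentiable_comp _ _ _ _ f L); first exact: df.
  exact: linear_differentiable.
apply: Cn_ext (IH _ (dfk v)) => x Ux.
have dL := linear_differentiable (f x) cL.
have /(congr1 (fun h => h v)) /= E := diff_comp (df x Ux) dL.
by rewrite [RHS]E diff_lin.
Qed.

Lemma CnZl (W : normedModType R) k (f : V -> R^o) (w : W) :
  Cn k U f -> Cn k U (fun x => f x *: w).
Proof.
move=> fk.
have lin : linear (fun a : R^o => a *: w).
  by move=> a x y; rewrite scalerDl scalerA.
pose L : {linear R^o -> W} :=
  HB.pack (fun a : R^o => a *: w) (GRing.isLinear.Build _ _ _ _ _ lin).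
by apply: (@Cn_lin _ _ k L) fk; exact: scalel_continuous.
Qed.

Lemma Cn_coord k n (f : V -> 'rV[R]_n) (i : 'I_n) :
  Cn k U f -> Cn k U (fun x => f x 0 i : R^o).
Proof.
move=> fk.
have lin : linear (fun a : 'rV[R]_n => a 0 i : R^o).
  by move=> a x y; rewrite !mxE.
pose L : {linear 'rV[R]_n -> R^o} :=
  HB.pack (fun a : 'rV[R]_n => a 0 i : R^o)
    (GRing.isLinear.Build _ _ _ _ _ lin).
by apply: (@Cn_lin _ _ k L) fk; exact: coord_continuous.
Qed.

Lemma Cn_row k n (f : V -> 'rV[R]_n) :
  (forall i, Cn k U (fun x => f x 0 i : R^o)) -> Cn k U f.
Proof.
move=> fk.
have := Cn_sum (fun i => CnZl (delta_mx 0 i : 'rV[R]_n) (fk i)).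
by apply: Cn_ext => x _; rewrite -row_sum_delta.
Qed.

End Rules.

Lemma diff_row (W : normedModType R) n (g : 'rV[R]_n -> W) (y v : 'rV[R]_n) :
  'd g y v = \sum_i v 0 i *: 'd g y (delta_mx 0 i).
Proof.
by rewrite [in LHS](row_sum_delta v) linear_sum; apply: eq_bigr => i _; rewrite linearZ.
Qed.

Section Comp.
Variables (V : normedModType R) (U : set V) (n : nat) (U' : set 'rV[R]_n).
Hypotheses (oU : open U) (oU' : open U').

Lemma Cn_comp1 k (f : V -> 'rV[R]_n) (g : 'rV[R]_n -> R^o) :
  (forall x, U x -> U' (f x)) -> Cn k U f -> Cn k U' g -> Cn k U (g \o f).
Proof.
move=> fU; elim: k g => [|k IH] g fk gk.
  move=> x Ux; apply: continuous_comp; first exact: fk.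
  by apply: gk; exact: fU.
have [df dfk] := fk; have [dg dgk] := gk; split=> [x Ux|v].
  by apply: differentiable_comp; [exact: df|apply: dg; exact: fU].
have := Cn_sum oU (fun i => CnM oU (@Cn_coord _ _ oU _ _ _ i (dfk v))
  (IH _ (Cn_pred fk) (dgk (delta_mx 0 i)))).
apply: Cn_ext => // x Ux; symmetry.
have /(congr1 (fun h => h v)) /= E := diff_comp (df x Ux) (dg _ (fU x Ux)).
by rewrite [LHS]E diff_row.
Qed.

Lemma Cn_comp k m (f : V -> 'rV[R]_n) (g : 'rV[R]_n -> 'rV[R]_m) :
  (forall x, U x -> U' (f x)) -> Cn k U f -> Cn k U' g -> Cn k U (g \o f).
Proof.
move=> fU fk gk; apply: Cn_row => // i.
by apply: (@Cn_comp1 k f (fun y => g y 0 i)) => //; exact: Cn_coord.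
Qed.

End Comp.
End Smooth.

(* An atlas of dimension n on a bare set: charts are injections
   [phi c : dom c -> R^n] (with [psi c] a left inverse on [dom c]) with open
   images of overlaps and smooth transition maps.  [chart_at] selects one chart
   around every point and serves to present tangent spaces, see [tangent]. *)
Record atlas (R : realType) (T : Type) (n : nat) := Atlas {
  chart : Type;
  dom : chart -> set T;
  phi : chart -> T -> 'rV[R]_n;
  psi : chart -> 'rV[R]_n -> T;
  chart_at : T -> chart;
  dom_chart_at : forall x, dom (chart_at x) x;
  phiK : forall c x, dom c x -> psi c (phi c x) = x;
  overlap_open : forall c d, open (phi c @` (dom c `&` dom d));
  transition_smooth : forall c d,
    smooth (phi c @` (dom c `&` dom d)) (phi d \o psi c)
}.

Arguments overlap_open {R T n} a c d.
Arguments transition_smooth {R T n} a c d.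
Arguments dom_chart_at {R T n} a x.

Definition smooth_on (R : realType) (T : Type) (n : nat) (A : atlas R T n)
    (W : normedModType R) (U : set T) (f : T -> W) : Prop :=
  forall c : chart A, smooth (phi c @` (dom c `&` U)) (f \o psi c).

Record manifold (R : realType) := Manifold {
  space :> topologicalType;
  mdim : nat;
  matlas : atlas R space mdim;
  open_atlasE : forall U : set space,
    open U <-> forall c : chart matlas, open (phi c @` (dom c `&` U));
  space_hausdorff : hausdorff_space space;
  space_second_countable : @second_countable space
}.
Arguments matlas {R} m.

(* A vector bundle as its family of fibres with local trivializations
   [triv i x : E_x -> R^rank] over open sets [tdom i]; the maps are only
   meaningful for [x] in [tdom i]. *)
Record vbundle (R : realType) (M : manifold R) := VBundle {
  rank : nat;
  fibre :> M -> vectType R;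
  tix : Type;
  tdom : tix -> set M;
  triv : tix -> forall x, {linear fibre x -> 'rV[R]_rank};
  untriv : tix -> forall x, {linear 'rV[R]_rank -> fibre x};
  triv_at : M -> tix;
  tdom_open : forall i, open (tdom i);
  tdom_at : forall x, tdom (triv_at x) x;
  trivK : forall i x, tdom i x -> cancel (triv i x) (untriv i x);
  untrivK : forall i x, tdom i x -> cancel (untriv i x) (triv i x);
  triv_smooth : forall i j u,
    smooth_on (matlas M) (tdom i `&` tdom j)
      (fun x => triv j x (untriv i x u))
}.

Section AtlasTheory.
Context {R : realType} {T : Type} {n : nat} (A : atlas R T n).

Lemma psiK (c : chart A) (U : set T) w :
  (phi c @` (dom c `&` U)) w -> phi c (psi c w) = w.
Proof. by move=> [x [dx _] <-]; rewrite phiK. Qed.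

Lemma phi_psi_id (c : chart A) (U : set T) w : (phi c @` (dom c `&` U)) w ->
  dom c (psi c w) /\ U (psi c w).
Proof. by move=> [x [dx Ux] <-]; rewrite phiK. Qed.

Lemma transition_diff (c d : chart A) x : dom c x -> dom d x ->
  differentiable (phi d \o psi c) (phi c x).
Proof. by move=> cx dx; have [+ _] := transition_smooth _ c d 1%N; apply; exists x. Qed.

Lemma diff_comp_at (V W X : normedModType R) (f : V -> W) (g : W -> X) x y v :
  y = f x -> differentiable f x -> differentiable g y ->
  'd (g \o f) x v = 'd g y ('d f x v).
Proof. by move=> -> df dg; exact: (congr1 (fun h : V -> X => h v) (diff_comp df dg)). Qed.

Lemma transition_cocycle (c a d : chart A) x (v : 'rV[R]_n) : dom c x -> dom a x -> dom d x ->
  'd (phi d \o psi a) (phi a x) ('d (phi a \o psi c) (phi c x) v)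
  = 'd (phi d \o psi c) (phi c x) v.
Proof.
move=> cx ax dx.
have Da := transition_diff cx ax.
have Dd := transition_diff ax dx.
have e : phi a x = (phi a \o psi c) (phi c x) by rewrite /= (phiK cx).
apply: etrans (esym (diff_comp_at v e Da Dd)) _.
have /near_diff : \forall w \near phi c x, (phi d \o psi c) w =
    ((phi d \o psi a) \o (phi a \o psi c)) w.
  apply: filterS (open_nbhs_nbhs (conj (overlap_open _ c a) _)).
    by move=> w /phi_psi_id[_ aw] /=; rewrite phiK.
  by exists x.
case/(_ (transition_diff cx dx)) => _ E.
exact: (congr1 (fun h : 'rV[R]_n -> 'rV[R]_n => h v) E).
Qed.

Lemma transition_id (c : chart A) x (v : 'rV[R]_n) : dom c x ->
  'd (phi c \o psi c) (phi c x) v = v.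
Proof.
move=> cx.
have := @near_diff _ _ _ (@idfun 'rV[R]_n) (phi c \o psi c) (phi c x).
case.
- apply: filterS (open_nbhs_nbhs (conj (overlap_open _ c c) _)).
    by move=> w /= cw; rewrite (psiK cw).
  by exists x.
- exact: ex_diff.
- move=> _ E.
  apply: etrans (congr1 (fun h : 'rV[R]_n -> 'rV[R]_n => h v) E) _.
  by rewrite diff_val.
Qed.

End AtlasTheory.

Section Bundles.
Context {R : realType} {M : manifold R}.
Local Notation n := (mdim M).

Lemma image_open (c : chart (matlas M)) (U : set M) : open U ->
  open (phi c @` (dom c `&` U)).
Proof. by move=> /open_atlasE. Qed.

Lemma tangent_smooth (c d : chart (matlas M)) (u : 'rV[R]_n) :
  smooth_on (matlas M) (dom c `&` dom d)
    (fun x : M => 'd (phi d \o psi (chart_at (matlas M) x))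
                     (phi (chart_at (matlas M) x) x)
                  ('d (phi (chart_at (matlas M) x) \o psi c) (phi c x) u)).
Proof.
have odom (e : chart (matlas M)) : open (dom e).
  by apply/open_atlasE => b; exact: overlap_open.
move=> b k.
have oV : open (phi b @` (dom b `&` (dom c `&` dom d))).
  by apply: image_open; exact: openI.
have [_ /(_ u) Tk] := transition_smooth _ c d k.+1.
have Pk : Cn k (phi b @` (dom b `&` (dom c `&` dom d)))
    (phi c \o psi b).
  apply: Cn_sub (transition_smooth _ b c k) => w [x [bx [cx _]] <-].
  by exists x.
apply: (Cn_ext oV _ (Cn_comp oV (overlap_open _ c d) _ Pk Tk)).
- move=> w /phi_psi_id [_ [cw dw]].
  exact: esym (transition_cocycle u cw (dom_chart_at _ _) dw).
- by move=> w /phi_psi_id [_ cdw]; exists (psi b w).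
Qed.

(* The fibre T_x M is R^n: a tangent vector at x is recorded by its components
   in the preferred chart [chart_at x], and the trivialization over [dom c]
   converts these to components in the chart c by the Jacobian at x. *)
Program Definition tangent : vbundle M := {|
  rank := n;
  fibre := fun=> 'rV[R]_n;
  tix := chart (matlas M);
  tdom := @dom _ _ _ (matlas M);
  triv := fun c x => 'd (phi c \o psi (chart_at (matlas M) x))
                        (phi (chart_at (matlas M) x) x);
  untriv := fun c x => 'd (phi (chart_at (matlas M) x) \o psi c) (phi c x);
  triv_at := chart_at (matlas M)
|}.
Next Obligation. by move=> i; apply/open_atlasE => c; exact: overlap_open. Qed.
Next Obligation. exact: dom_chart_at. Qed.
Next Obligation.
move=> c x cx v; have ax := dom_chart_at (matlas M) x.
exact: etrans (transition_cocycle v ax cx ax) (transition_id v ax).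
Qed.
Next Obligation.
move=> c x cx v; have ax := dom_chart_at (matlas M) x.
exact: etrans (transition_cocycle v cx ax cx) (transition_id v cx).
Qed.
Next Obligation. by move=> c d u; exact: tangent_smooth. Qed.

End Bundles.

Section Dual.
Context {R : realType} {M : manifold R} (E : vbundle M).
Local Notation r := (rank E).

Definition dual_triv i x (a : 'Hom(E x, R^o)) : 'rV[R]_r :=
  \row_k a (untriv i x (delta_mx 0 k)).

Definition pairing i x (u : 'rV[R]_r) (e : E x) : R^o :=
  \sum_k u 0 k * triv i x e 0 k.

Definition dual_untriv i x (u : 'rV[R]_r) : 'Hom(E x, R^o) :=
  linfun (pairing i u).

Lemma dual_triv_linear i x : linear (@dual_triv i x).
Proof. by move=> a f g; apply/rowP => k; rewrite !mxE add_lfunE scale_lfunE. Qed.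

Lemma pairing_linear i x u : linear (@pairing i x u).
Proof.
move=> a e e'; rewrite /pairing scaler_sumr -big_split; apply: eq_bigr => k _.
by rewrite linearP !mxE mulrDr mulrCA.
Qed.
HB.instance Definition _ i x u :=
  GRing.isLinear.Build R (E x) R^o _ (@pairing i x u) (@pairing_linear i x u).

Lemma dual_untriv_linear i x : linear (@dual_untriv i x).
Proof.
move=> a u v; apply/lfunP => e.
rewrite add_lfunE scale_lfunE !lfunE /= /pairing.
rewrite scaler_sumr -big_split; apply: eq_bigr => k _.
by rewrite !mxE mulrDl -mulrA.
Qed.

HB.instance Definition _ i x :=
  GRing.isLinear.Build R _ _ _ (@dual_triv i x) (@dual_triv_linear i x).
HB.instance Definition _ i x :=
  GRing.isLinear.Build R _ _ _ (@dual_untriv i x) (@dual_untriv_linear i x).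

Lemma dual_trivK i x : tdom i x -> cancel (@dual_triv i x) (@dual_untriv i x).
Proof.
move=> ix a; apply/lfunP => e; rewrite lfunE /= /pairing.
rewrite -[in RHS](trivK ix e) (row_sum_delta (triv i x e)) !linear_sum /=.
by apply: eq_bigr => k _; rewrite !mxE !linearZ /= mulrC -row_sum_delta.
Qed.

Lemma dual_untrivK i x : tdom i x -> cancel (@dual_untriv i x) (@dual_triv i x).
Proof.
move=> ix u; apply/rowP => k; rewrite !mxE lfunE /= /pairing untrivK //.
rewrite (bigD1 k) //= big1 ?addr0 => [|l lk]; first by rewrite !mxE !eqxx mulr1.
by rewrite !mxE (negbTE lk) andbF mulr0.
Qed.

Lemma dual_triv_smooth i j u :
  smooth_on (matlas M) (tdom i `&` tdom j)
    (fun x => dual_triv j (dual_untriv i x u)).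
Proof.
move=> c k.
have oU : open (phi c @` (dom c `&` (@tdom _ _ E i `&` tdom j))).
  by apply: image_open; apply: openI; exact: tdom_open.
apply: Cn_row => // l.
have tk := @triv_smooth _ _ E j i (delta_mx 0 l) c k.
rewrite [X in _ `&` X]setIC in tk.
apply: Cn_ext (Cn_sum oU (fun m : 'I_r =>
  CnM oU (Cn_cst oU k (u 0 m : R^o)) (Cn_coord oU m tk))) => // w _.
by rewrite /= mxE lfunE.
Qed.

Definition dual : vbundle M := {|
  rank := r;
  fibre := fun x => 'Hom(E x, R^o) : vectType R;
  tix := tix E;
  tdom := @tdom _ _ E;
  triv := fun i x => @dual_triv i x : {linear _ -> _};
  untriv := fun i x => @dual_untriv i x : {linear _ -> _};
  triv_at := @triv_at _ _ E;
  tdom_open := @tdom_open _ _ E;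
  tdom_at := @tdom_at _ _ E;
  trivK := dual_trivK;
  untrivK := dual_untrivK;
  triv_smooth := dual_triv_smooth
|}.

End Dual.

Section Total.
Context {R : realType} {M : manifold R} (E : vbundle M).
Local Notation n := (mdim M).
Local Notation r := (rank E).
Local Notation total := {x : M & E x}.
Local Notation ix := (chart (matlas M) * tix E)%type.

Definition total_dom (c : ix) : set total :=
  [set p | dom c.1 (projT1 p) /\ tdom c.2 (projT1 p)].

Definition total_phi (c : ix) (p : total) : 'rV[R]_(n + r) :=
  row_mx (phi c.1 (projT1 p)) (triv c.2 (projT1 p) (projT2 p)).

Definition total_psi (c : ix) (w : 'rV[R]_(n + r)) : total :=
  let x := psi c.1 (lsubmx w) in existT _ x (untriv c.2 x (rsubmx w)).

Definition total_chart_at (p : total) : ix :=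
  (chart_at (matlas M) (projT1 p), triv_at E (projT1 p)).

Lemma total_dom_at p : total_dom (total_chart_at p) p.
Proof. by split; [exact: dom_chart_at|exact: tdom_at]. Qed.

Lemma total_phiK c p : total_dom c p -> total_psi c (total_phi c p) = p.
Proof.
case: c p => c i [x v] [/= cx ix]; rewrite /total_psi /total_phi /=.
by rewrite row_mxKl row_mxKr phiK // trivK.
Qed.

Lemma total_overlapE c d :
  total_phi c @` (total_dom c `&` total_dom d) =
  lsubmx @^-1` (phi c.1 @` (dom c.1 `&`
    (dom d.1 `&` (@tdom _ _ E c.2 `&` tdom d.2)))).
Proof.
case: c d => c i [d j]; apply/seteqP; split=> w /=.
  move=> [[x v] [/= [cx ix] [dx jx]] <-]; rewrite /total_phi /= row_mxKl.
  by exists x.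
move=> [x [cx [dx [ix jx]]] xw].
exists (existT _ x (untriv i x (rsubmx w))) => //.
by rewrite /total_phi /= untrivK // xw hsubmxK.
Qed.

Lemma total_overlap_open c d :
  open (total_phi c @` (total_dom c `&` total_dom d)).
Proof.
rewrite total_overlapE; apply: open_comp.
  by move=> w _; exact: continuous_lsubmx.
apply: image_open; apply: openI.
  by apply/open_atlasE => b; exact: overlap_open.
by apply: openI; exact: tdom_open.
Qed.

Lemma total_transition_smooth c d :
  smooth (total_phi c @` (total_dom c `&` total_dom d))
    (total_phi d \o total_psi c).
Proof.
move=> k; have oU := @total_overlap_open c d.
set U := (X in Cn k X) in oU *.
pose U' := phi c.1 @` (dom c.1 `&` (dom d.1 `&` (@tdom _ _ E c.2 `&` tdom d.2))).
have oU' : open U'.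
  apply: image_open; apply: openI.
    by apply/open_atlasE => b; exact: overlap_open.
  by apply: openI; exact: tdom_open.
have UU' w : U w -> U' (lsubmx w) by rewrite /U total_overlapE.
have id_smooth := Cn_id oU k.
have lk : Cn k U (lsubmx : _ -> 'rV[R]_n).
  apply: Cn_row => // m.
  by apply: Cn_ext (Cn_coord oU (lshift r m) id_smooth) => // w _; rewrite mxE.
have rk : Cn k U (rsubmx : _ -> 'rV[R]_r).
  apply: Cn_row => // m.
  by apply: Cn_ext (Cn_coord oU (rshift n m) id_smooth) => // w _; rewrite mxE.
have bk : Cn k U ((phi d.1 \o psi c.1) \o lsubmx).
  apply: (Cn_comp oU oU') => //.
  apply: Cn_sub (transition_smooth _ c.1 d.1 k) => w [x [cx [dx _]] <-].
  by exists x.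
have fk (m : 'I_r) : Cn k U
    ((fun w => triv d.2 (psi c.1 w) (untriv c.2 (psi c.1 w) (delta_mx 0 m)))
      \o lsubmx).
  apply: (Cn_comp oU oU') => //.
  apply: Cn_sub (@triv_smooth _ _ E c.2 d.2 (delta_mx 0 m) c.1 k).
  by move=> w [x [cx [_ ijx]] <-]; exists x.
apply: Cn_row => // l; case: (split_ordP l) => l' ->.
  by apply: Cn_ext (Cn_coord oU l' bk) => // w _; rewrite /= row_mxEl.
apply: Cn_ext (Cn_sum oU (fun m : 'I_r =>
  CnM oU (Cn_coord oU m rk) (Cn_coord oU l' (fk m)))) => // w _.
rewrite /= row_mxEr /=.
rewrite [in RHS](row_sum_delta (rsubmx w)) !linear_sum summxE.
apply: eq_bigr => m _.
by rewrite linearZ linearZ [RHS]mxE.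
Qed.

(* The manifold structure of the total space: over [dom c `&` tdom i] the point
   (x, v) has coordinates (phi c x, triv i x v). *)
Definition total_atlas : atlas R total (n + r) := {|
  chart := ix;
  dom := total_dom;
  phi := total_phi;
  psi := total_psi;
  chart_at := total_chart_at;
  dom_chart_at := total_dom_at;
  phiK := total_phiK;
  overlap_open := @total_overlap_open;
  transition_smooth := @total_transition_smooth
|}.

End Total.

Record smooth_fun (R : realType) (T : Type) (n : nat) (A : atlas R T n) :=
  SmoothFun {
    sfun :> T -> R^o;
    sfun_smooth : smooth_on A setT sfun
  }.

(* The derivative of f along a tangent vector v at p, with the same
   presentation of the tangent space at p as in [tangent]. *)
Definition deriv (R : realType) (T : Type) (n : nat) (A : atlas R T n)
    (f : T -> R^o) (p : T) (v : 'rV[R]_n) : R^o :=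
  'd (f \o psi (chart_at A p)) (phi (chart_at A p) p) v.

(* The tangent space at p being R^n, an element of its tensor square is an
   n x n matrix L, standing for \sum_(i, j) L i j e_i (x) e_j; the bracket
   {f, g} is its evaluation on (df, dg). *)
Definition bracket (R : realType) (T : Type) (n : nat) (A : atlas R T n)
    (L : T -> 'M[R]_n) (f g : T -> R^o) (p : T) : R^o :=
  \sum_i \sum_j
    L p i j * deriv A f p (delta_mx 0 i) * deriv A g p (delta_mx 0 j).

(* Smoothness of a 2-contravariant tensor field is smoothness of its components
   L(d phi_i, d phi_j) in every chart phi. *)
Record tensor2 (R : realType) (T : Type) (n : nat) (A : atlas R T n) :=
  Tensor2 {
    tens :> T -> 'M[R]_n;
    tens_smooth : forall (c : chart A) i j,
      smooth_on A (dom c)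
        (bracket A tens (fun q => phi c q 0 i) (fun q => phi c q 0 j))
  }.

Definition skew_tensor (R : realType) (T : Type) (n : nat) (A : atlas R T n)
    (L : tensor2 A) : Prop :=
  forall p, (L p)^T = - L p.

Definition poisson_tensor (R : realType) (T : Type) (n : nat)
    (A : atlas R T n) (L : tensor2 A) : Prop :=
  skew_tensor L /\
  forall (f g h : smooth_fun A) p,
    bracket A L f (bracket A L g h) p + bracket A L g (bracket A L h f) p
    + bracket A L h (bracket A L f g) p = 0.

Record Gamma (R : realType) (M : manifold R) (E : vbundle M) := MkGamma {
  sec :> forall x, E x;
  sec_smooth : forall i : tix E,
    smooth_on (matlas M) (tdom i) (fun x => triv i x (sec x))
}.

Record bundle_map (R : realType) (M : manifold R) (E F : vbundle M) :=
  BundleMap {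
    bmap :> forall x, {linear E x -> F x};
    bmap_smooth : forall (i : tix E) (j : tix F) u,
      smooth_on (matlas M) (tdom i `&` tdom j)
        (fun x => triv j x (bmap x (untriv i x u)))
  }.

Section Sections.
Context {R : realType} {M : manifold R} (E : vbundle M).

Lemma sec_add_smooth (X Y : Gamma E) (i : tix E) :
  smooth_on (matlas M) (tdom i) (fun x => triv i x (X x + Y x)).
Proof.
move=> c k; have oU := @image_open _ _ c _ (tdom_open i).
apply: Cn_ext (CnD oU (sec_smooth X i c k) (sec_smooth Y i c k)) => // w _.
by rewrite /= linearD.
Qed.

Lemma sec_scale_smooth (f : smooth_fun (matlas M)) (X : Gamma E) (i : tix E) :
  smooth_on (matlas M) (tdom i) (fun x => triv i x (f x *: X x)).
Proof.
move=> c k; have oU := @image_open _ _ c _ (tdom_open i).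
apply: Cn_row => // l.
have fk : Cn k (phi c @` (dom c `&` tdom i)) (f \o psi c).
  by apply: Cn_sub (sfun_smooth f c k) => w [x [cx _] <-]; exists x.
apply: Cn_ext (CnM oU fk (Cn_coord oU l (sec_smooth X i c k))) => // w _.
by rewrite /= linearZ mxE.
Qed.

Lemma cst_smooth (a : R) : smooth_on (matlas M) setT (fun=> a : R^o).
Proof. by move=> c k; apply: Cn_cst; apply: image_open; exact: openT. Qed.

Definition sec_add (X Y : Gamma E) : Gamma E := MkGamma (sec_add_smooth X Y).
Definition sec_scale (f : smooth_fun (matlas M)) (X : Gamma E) : Gamma E :=
  MkGamma (sec_scale_smooth f X).
Definition cst_fun (a : R) : smooth_fun (matlas M) := SmoothFun (cst_smooth a).

Record pseudo_lie_algebroid := PseudoLieAlgebroid {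
  br : Gamma E -> Gamma E -> Gamma E;
  anchorl : bundle_map E tangent;
  anchorr : bundle_map E tangent;
  br_linearl : forall a X Y Z,
    br (sec_add (sec_scale (cst_fun a) X) Y) Z =
    sec_add (sec_scale (cst_fun a) (br X Z)) (br Y Z);
  br_linearr : forall a X Y Z,
    br X (sec_add (sec_scale (cst_fun a) Y) Z) =
    sec_add (sec_scale (cst_fun a) (br X Y)) (br X Z);
  br_leibniz : forall f g X Y x,
    br (sec_scale f X) (sec_scale g Y) x =
      (f x * deriv (matlas M) g x (anchorl x (X x))) *: Y x
      - (g x * deriv (matlas M) f x (anchorr x (Y x))) *: X x
      + (f x * g x) *: br X Y x
}.

Definition pre_lie (A : pseudo_lie_algebroid) : Prop :=
  forall X Y x, br A X Y x = - br A Y X x.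

Definition lie (A : pseudo_lie_algebroid) : Prop :=
  pre_lie A /\
  forall X Y Z x,
    br A X (br A Y Z) x + br A Y (br A Z X) x + br A Z (br A X Y) x = 0.

Definition dual_space : Type := {x : M & dual E x}.
Definition dual_atlas : atlas R dual_space (mdim M + rank E) :=
  total_atlas (dual E).

Definition iota (X : Gamma E) (p : dual_space) : R^o :=
  (projT2 p : 'Hom(E (projT1 p), R^o)) (X (projT1 p)).

Definition pullback (f : M -> R^o) (p : dual_space) : R^o := f (projT1 p).

Definition fibre_linear (F : dual_space -> R^o) : Prop :=
  forall x, linear (fun a : dual E x => F (existT _ x a)).

Definition linear_tensor (L : tensor2 dual_atlas) : Prop :=
  forall X Y : Gamma E, fibre_linear (bracket dual_atlas L (iota X) (iota Y)).

Definition corresponds (A : pseudo_lie_algebroid) (L : tensor2 dual_atlas) :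
    Prop :=
  [/\ forall X Y : Gamma E, iota (br A X Y) = bracket dual_atlas L (iota X) (iota Y),
      forall (X : Gamma E) (f : smooth_fun (matlas M)),
        pullback (fun x => deriv (matlas M) f x (anchorl A x (X x))) =
        bracket dual_atlas L (iota X) (pullback f)
    & forall (X : Gamma E) (f : smooth_fun (matlas M)),
        pullback (fun x => deriv (matlas M) f x (anchorr A x (X x))) =
        (fun p => - bracket dual_atlas L (pullback f) (iota X) p)].

End Sections.

(* Main.v *)
Require Import Defs.
From HB Require Import structures.
From mathcomp Require Import all_boot all_order all_algebra.
From mathcomp Require Import all_classical all_reals all_analysis.
From mathcomp Require Import ring lra.
Set Implicit Arguments.
Unset Strict Implicit.
Unset Printing Implicit Defensive.
Import Defs Order.TTheory GRing.Theory Num.Theory.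
Import numFieldNormedType.Exports.
Local Open Scope classical_set_scope.
Local Open Scope ring_scope.

(** On the chart of E* given by a chart of M and a frame (e_k) of E, the coordinates are
    the base coordinates and the fibre coordinates xi_k = iota e_k, so a linear tensor is
    the block matrix with entries {x_i, x_j} = 0, {xi_k, x_j} and -{x_j, xi_k} given by the
    anchors, and {xi_k, xi_l} = iota [e_k, e_l].

    Since d(iota (f X)) = f d(iota X) + iota X d(pi^* f), the differentials of the functions
    iota X exhaust the cotangent spaces of E* off the zero section. As the rank is positive
    the zero section has a dense complement, so everything determined by differentials
    (the tensor itself, its skew part, and the Jacobiator, which depends only on
    differentials because Hessians are symmetric) can be tested on the functions iota X.

    For a linear tensor, iota Y {iota X, pi^* f} = {iota X, iota (f Y)} - pi^* f {iota X, iota Y}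
    is fibrewise linear for every Y; this forces {iota X, pi^* f} to be constant on the
    fibres. The same argument applied to the opposite of the transpose, and then to
    {pi^* f, iota (g X)}, gives the right anchor and {pi^* f, pi^* g} = 0. *)

(** * Smooth bump functions and symmetry of second derivatives *)

(** Brackets of sections are global data, whereas a tensor is a pointwise object. Bump functions
    make the passage: the Leibniz rule with a cut-off factor makes the bracket local, and germs of
    functions and sections extend to all of M. Tangent vectors at p are recorded in the preferred
    chart of p, which may jump with p, so the matrix field of a tensor says nothing by itself about
    smoothness; arguments of regularity or continuity go through brackets of functions. The Jacobi
    identity of a Poisson tensor is asked of all smooth functions on E*, not only of fibrewise
    linear ones. Two functions with the same differential at p differ by one that is critical at p,
    and there the Jacobiator reduces to second derivatives of that function; this is why symmetric
    Hessians are needed. Positive rank is essential: in rank 0 the space E* is M and every [iota X]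
    vanishes, so any tensor on M corresponds to the only algebroid structure, and uniqueness fails
    as soon as M is nonempty of positive dimension. *)

Section Flat.
Context {R : realType}.

(** The function t^(-m) exp(-1/t), continued by 0. The exponent m is carried along because the m-th
    derivative formula involves the functions of index m+2 and m+1, so that smoothness of the whole
    family goes by one induction on the order, for all m at once. *)
Definition flat (m : nat) (t : R^o) : R^o :=
  if 0 < t then t^-1 ^+ m * expR (- t^-1) else 0.

Lemma flat_ge0 m t : 0 <= flat m t.
Proof.
rewrite /flat; case: ltP => // t0.
by rewrite mulr_ge0 ?expR_ge0// exprn_ge0// invr_ge0 ltW.
Qed.

(** The exponential at 1/t is at least its Taylor term of order m+2, which beats t^(-m) by a factor
    t^2. A quadratic bound is what sends the difference quotient at 0 to 0. *)
Lemma flat_bound m (t : R) : `|flat m t| <= (m.+2)`!%:R * t ^+ 2.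
Proof.
rewrite ger0_norm ?flat_ge0// /flat; case: ltP => t0; last first.
  by rewrite mulr_ge0// sqr_ge0.
have t10 : 0 <= t^-1 by rewrite invr_ge0 ltW.
have := expR_ge1Dxn m.+1 t10 => H.
rewrite expRN ler_pdivrMr ?expR_gt0// -mulrA [t ^+ 2 * _]mulrC mulrA.
rewrite -ler_pdivrMr ?exprn_gt0// -exprVn -exprD addn2.
rewrite mulrC -ler_pdivrMr ?ltr0n ?fact_gt0//.
by apply: le_trans H; rewrite lerDr.
Qed.

Lemma is_derive_flat m (t : R) :
  is_derive t 1 (flat m) (flat m.+2 t - m%:R * flat m.+1 t).
Proof.
have [t0|t0|->] := ltgtP t 0.
- rewrite /flat [in X in is_derive _ _ _ X]ltNge (ltW t0) /= mulr0 subr0.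
  apply: (@near_eq_is_derive _ _ _ (cst 0)) => //.
  near=> z; rewrite /cst ifF//; apply/negbTE; rewrite -leNgt ltW//.
  by near: z; exact: lt_nbhsl.
- rewrite /flat [in X in is_derive _ _ _ X]t0.
  apply: (@near_eq_is_derive _ _ _ (fun t : R^o => t^-1 ^+ m * expR (- t^-1) : R^o)) => //.
  + near=> z; rewrite ifT//; by near: z; exact: lt_nbhsr.
  + have tn0 : t != 0 by rewrite gt_eqF.
    have iV : is_derive t 1 (fun t : R => t^-1) (- (t ^- 2)).
      apply: DeriveDef; first exact: derivableV.
      by rewrite deriveV// derive_id [LHS]mulr1.
    have iE : is_derive t 1 (expR \o -%R \o (fun t : R => t^-1))
                (expR (- t^-1) * - 1 * - (t ^- 2)).
      by apply: is_derive1_comp; apply: is_derive1_comp.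
    have iX := @is_deriveX _ _ (fun t : R => t^-1) m t 1 _ iV.
    have := @is_deriveM _ _ _ _ _ _ _ _ iX iE.
    rewrite (_ : _ * _ = (fun t => t^-1 ^+ m * expR (- t^-1))); last first.
      by apply/funext => z; rewrite !fctE.
    move=> H; refine (is_derive_eq H _).
    rewrite /GRing.scale /= !fctE; case: m {iX H} => [|m].
      by rewrite !mul0r mulr0 addr0 !expr0 subr0 -exprVn; ring.
    by rewrite -exprVn !exprS /=; ring.
- have f0 k : flat k 0 = 0 by rewrite /flat ltxx.
  rewrite !f0 mulr0 subr0.
  have cv : h^-1 *: (flat m (h *: 1 + 0) - flat m 0) @[h --> (0:R)^'] --> (0 : R^o).
    apply/cvgr0Pnorm_le => e e0.
    have C0 : 0 < (m.+2)`!%:R :> R by rewrite ltr0n fact_gt0.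
    near=> h; rewrite f0 subr0 addr0 [h *: 1]mulr1 normrZ.
    have h0 : h != 0 by near: h; exact: nbhs_dnbhs_neq.
    rewrite normfV ler_pdivrMl ?normr_gt0//.
    apply: le_trans (flat_bound m h) _.
    rewrite -[h ^+ 2]real_normK ?num_real// expr2 mulrA mulrC.
    rewrite ler_pM2l ?normr_gt0// -ler_pdivlMl// mulrC.
    near: h; apply: dnbhs0_le; exact: divr_gt0.
  by apply: DeriveDef; [apply/cvg_ex; exists 0|exact: cvg_lim].
Unshelve. all: by end_near. Qed.

Lemma diff_flat m (t v : R^o) : differentiable (flat m) t /\
  'd (flat m) t v = v * (flat m.+2 t - m%:R * flat m.+1 t).
Proof.
have [d1 d2] := is_derive_flat m t; split; first exact/derivable1_diffP.
by rewrite diff1E; [rewrite derive1E d2|exact/derivable1_diffP].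
Qed.

Lemma flat_smooth m : smooth setT (flat m).
Proof.
move=> k; elim: k m => [|k IH] m.
  by move=> x _; apply: differentiable_continuous; have [] := diff_flat m x 0.
split=> [x _|v]; first by have [] := diff_flat m x 0.
have c (w : R^o) : Cn k [set: R^o] (fun=> w : R^o) by apply: Cn_cst; exact: openT.
have oT : open [set: R^o] by exact: openT.
have := CnM oT (c v) (CnD oT (IH m.+2) (CnM oT (c (- m%:R)) (IH m.+1))).
apply: (Cn_ext oT).
by move=> x _; have [_ ->] := diff_flat m x v; rewrite mulNr.
Qed.

End Flat.

(** * Locality of C^k maps, symmetry of second derivatives, cut-off functions *)

Section Calculus.
Context {R : realType}.

Lemma Cn_local (V W : normedModType R) (U : set V) k (f : V -> W) :
  (forall x, U x -> exists2 U', U' x & Cn k U' f) -> Cn k U f.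
Proof.
elim: k f => [|k IH] f Uf /=.
  by move=> x /Uf[U' U'x]; apply.
split=> [x /Uf[U' U'x [+ _]]|v]; first exact.
by apply: IH => x /Uf[U' U'x [_ fk]]; exists U' => //; exact: fk.
Qed.

Lemma Cn_comp_scalar (V : normedModType R) (U : set V) (U' : set R^o) k
    (f : V -> R^o) (g : R^o -> R^o) : open U -> open U' ->
  (forall x, U x -> U' (f x)) -> Cn k U f -> Cn k U' g -> Cn k U (g \o f).
Proof.
move=> oU oU' fU; elim: k g => [|k IH] g fk gk.
  move=> x Ux; apply: continuous_comp; first exact: fk.
  by apply: gk; exact: fU.
have [df dfk] := fk; have [dg dgk] := gk; split=> [x Ux|v].
  by apply: differentiable_comp; [exact: df|apply: dg; exact: fU].
have := CnM oU (dfk v) (IH _ (Cn_pred fk) (dgk 1)).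
apply: Cn_ext => // x Ux; symmetry.
have /(congr1 (fun h => h v)) /= E := diff_comp (df x Ux) (dg _ (fU x Ux)).
rewrite [LHS]E -[X in 'd g (f x) X]mulr1.
by rewrite [LHS](linearZ_LR ('d g (f x)) ('d f x v) (1 : R^o)).
Qed.

Lemma is_derive_line (V : normedModType R) (h : V -> R^o) (x v : V) (s : R) :
  differentiable h (x + s *: v) ->
  is_derive s 1 (fun s => h (x + s *: v)) ('d h (x + s *: v) v).
Proof.
move=> dh.
have ds : differentiable ( *:%R ^~ v : R -> V) s by exact: ex_diff.
have dl : differentiable (fun s : R => x + s *: v) s.
  exact: (differentiableD (differentiable_cst x s) ds).
have El : 'd (fun s : R => x + s *: v) s = ( *:%R ^~ v) :> (R -> V).
  apply: etrans (diffD (differentiable_cst x s) ds) _.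
  by rewrite diff_cst diff_val; apply: add0r.
have dc : differentiable (h \o (fun s : R => x + s *: v)) s.
  exact: differentiable_comp.
apply: DeriveDef; first exact/derivable1_diffP.
by rewrite deriveE// diff_comp//= El scale1r.
Qed.

(** Two mean value theorems for the second difference of f over a parallelogram with sides t v and t
    w: along v for the difference between opposite edges, then along w for the derivative so
    obtained. *)
Lemma MVT_line2 (V : normedModType R) (f : V -> R^o) (x v w : V) (t : R) : 0 < t ->
  (forall s r : R, 0 <= s <= t -> 0 <= r <= t ->
     differentiable f (x + s *: v + r *: w) /\
     differentiable (fun y => 'd f y v) (x + s *: v + r *: w)) ->
  exists s r : R, [/\ 0 < s < t, 0 < r < t &
    f (x + t *: v + t *: w) - f (x + t *: v) - (f (x + t *: w) - f x)
      = t * (t * 'd (fun y => 'd f y v) (x + s *: v + r *: w) w)].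
Proof.
move=> t0 H.
pose g (r s : R) := f (x + r *: w + s *: v).
have dg r s : 0 <= s <= t -> 0 <= r <= t ->
    is_derive s 1 (g r) ('d f (x + s *: v + r *: w) v).
  move=> sI rI; rewrite addrAC; apply: is_derive_line.
  by rewrite addrAC; have [] := H s r sI rI.
have tI : 0 <= t <= t by rewrite lexx ltW.
have zI : 0 <= (0 : R) <= t by rewrite lexx ltW.
have dgg s : 0 <= s <= t -> is_derive s 1 (fun s => g t s - g 0 s)
    ('d f (x + s *: v + t *: w) v - 'd f (x + s *: v + 0 *: w) v).
  by move=> sI; apply: is_deriveB; apply: dg.
have itvW (a b s : R) : s \in `]a, b[ -> a <= s <= b.
  by rewrite in_itv /= => /andP[/ltW -> /ltW ->].
have [|s sI Es] := MVT t0 (fun s h => dgg s (itvW _ _ _ h)).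
  apply: derivable_within_continuous => s sI.
  by have [] := dgg s (ltac:(by move: sI; rewrite in_itv)).
have dh r : 0 <= r <= t -> is_derive r 1 (fun r => 'd f (x + s *: v + r *: w) v)
    ('d (fun y => 'd f y v) (x + s *: v + r *: w) w).
  by move=> rI; apply: is_derive_line; have [] := H s r (itvW _ _ _ sI) rI.
have [|r rI Er] := MVT t0 (fun r h => dh r (itvW _ _ _ h)).
  apply: derivable_within_continuous => r rI.
  by have [] := dh r (ltac:(by move: rI; rewrite in_itv)).
exists s, r; split; [by move: sI; rewrite in_itv|by move: rI; rewrite in_itv|].
rewrite Er subr0 in Es; rewrite mulrA mulrC mulrA -Es /g.
rewrite !scale0r !addr0 [x + t *: w + _]addrAC; ring.
Qed.

(** The second difference is symmetric in v and w, so [MVT_line2] in both orders gives a common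
    value to the two mixed derivatives, each taken at its own point near x; continuity brings both
    points to x. *)
Lemma diff_comm (V : normedModType R) (U : set V) (f : V -> R^o) (x v w : V) :
  open U -> U x -> Cn 2 U f ->
  'd (fun y => 'd f y v) x w = 'd (fun y => 'd f y w) x v.
Proof.
move=> oU Ux [df dfk].
have dd u y : U y -> differentiable (fun y => 'd f y u) y by have [] := dfk u; auto.
apply/eqP; rewrite -subr_eq0 -normr_eq0; apply/negP => /negP n0.
set A := 'd _ x w in n0 *; set B := 'd _ x v in n0 *.
have e0 : 0 < `|A - B| / 2 by rewrite divr_gt0// normr_gt0 -normr_gt0 lt_def n0 /=.
have cA : {for x, continuous (fun y => 'd (fun y => 'd f y v) y w)}.
  by have [_ /(_ w)] := dfk v; apply.
have cB : {for x, continuous (fun y => 'd (fun y => 'd f y w) y v)}.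
  by have [_ /(_ v)] := dfk w; apply.
move/cvgrPdist_lt : cA => /(_ _ e0) nA.
move/cvgrPdist_lt : cB => /(_ _ e0) nB.
have nU : \forall y \near x, U y by exact: open_nbhs_nbhs.
have /nbhs_ballP [d /= d0 H] : \forall y \near x, [/\ U y,
   `|A - 'd (fun y => 'd f y v) y w| < `|A - B| / 2 &
   `|B - 'd (fun y => 'd f y w) y v| < `|A - B| / 2].
  by near=> y; split; near: y.
(* Both parallelograms then stay in the ball of radius d; the summand 1 keeps the denominator
   positive and the inclusion strict. *)
pose t := d / (`|v| + `|w| + 1).
have D0 : 0 < `|v| + `|w| + 1 by rewrite ltr_wpDl// addr_ge0.
have t0 : 0 < t by rewrite divr_gt0.
have inb s r : 0 <= s <= t -> 0 <= r <= t -> ball x d (x + s *: v + r *: w).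
  move=> /andP[s0 st] /andP[r0 rt].
  rewrite -ball_normE /= -addrA opprD addrA subrr add0r normrN.
  apply: le_lt_trans (ler_normD _ _) _; rewrite !normrZ !ger0_norm//.
  have : t * (`|v| + `|w| + 1) = d by rewrite /t divfK ?gt_eqF.
  move=> <-; rewrite !mulrDr mulr1.
  apply: (@le_lt_trans _ _ (t * `|v| + t * `|w|)); last by rewrite ltrDl.
  by rewrite lerD// ler_wpM2r.
have [s [r [sI rI E]]] := @MVT_line2 _ f x v w t t0
  (fun s r sI rI => let: And3 h _ _ := H _ (inb s r sI rI) in
     conj (df _ h) (dd v _ h)).
have inb' s' r' : 0 <= s' <= t -> 0 <= r' <= t -> ball x d (x + s' *: w + r' *: v).
  by move=> sI' rI'; rewrite addrAC; exact: inb.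
have [s' [r' [sI' rI' E']]] := @MVT_line2 _ f x w v t t0
  (fun s r sI rI => let: And3 h _ _ := H _ (inb' s r sI rI) in
     conj (df _ h) (dd w _ h)).
have lW a : 0 < a < t -> 0 <= a <= t by move=> /andP[/ltW -> /ltW ->].
have [_ HA _] := H _ (inb _ _ (lW _ sI) (lW _ rI)).
have [_ _ HB] := H _ (inb' _ _ (lW _ sI') (lW _ rI')).
have EE : 'd (fun y => 'd f y v) (x + s *: v + r *: w) w =
          'd (fun y => 'd f y w) (x + s' *: w + r' *: v) v.
  have tn0 : t != 0 by rewrite gt_eqF.
  apply: (mulfI tn0); apply: (mulfI tn0); rewrite -E -E'.
  rewrite [x + t *: w + t *: v]addrAC; ring.
rewrite EE in HA.
have := ler_distD ('d (fun y => 'd f y w) (x + s' *: w + r' *: v) v) A B.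
rewrite leNgt => /negP; apply.
rewrite [X in _ < X](splitr `|A - B|); apply: ltrD => //.
by rewrite distrC.
Unshelve. all: by end_near. Qed.

(* Constant for [t <= 0], and zero as soon as [flat 0 t >= flat 0 1]. *)
Definition smooth_step (t : R^o) : R^o := 
  (flat 0 (flat 0 1))^-1 * flat 0 (flat 0 1 - flat 0 t).

Lemma smooth_step_smooth k : Cn k setT smooth_step.
Proof.
have oT : open [set: R^o] by exact: openT.
apply: (CnM oT (Cn_cst oT k _)).
have h : Cn k [set: R^o] (fun t => flat 0 1 - flat 0 t : R^o).
  apply: (CnD oT (Cn_cst oT k _)).
  apply: (Cn_ext oT _ (CnM oT (Cn_cst oT k (-1 : R^o)) (@flat_smooth R 0 k))).
  by move=> t _; rewrite mulN1r.
exact: (Cn_comp_scalar oT oT _ h (@flat_smooth R 0 k)).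
Qed.

Lemma smooth_step_le0 t : t <= 0 -> smooth_step t = 1.
Proof.
move=> t0; rewrite /smooth_step.
have -> : flat 0 t = 0 by rewrite /flat ltNge t0.
rewrite subr0; apply: (@mulVf R).
have c0 : 0 < flat 0 (1 : R) by rewrite /flat ltr01 expr0 mul1r expR_gt0.
by rewrite {1}/flat c0 expr0 mul1r expR_eq0.
Qed.

Lemma smooth_step_ge1 t : 1 <= t -> smooth_step t = 0.
Proof.
move=> t1; rewrite /smooth_step [X in _ * X](_ : _ = 0) ?mulr0//.
have t0 : 0 < t by apply: lt_le_trans t1.
rewrite /flat ifF//; apply/negbTE; rewrite -leNgt subr_le0.
rewrite ltr01 t0 !expr0 !mul1r ler_expR lerN2 invr1.
by rewrite invf_le1.
Qed.

(** The norm of row vectors is the maximum norm, which is not smooth. It is replaced by the scaled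
    sum of squares [q], which is at least 1 wherever the maximum norm of w - w0 exceeds e. *)
Lemma bump_rV n (w0 : 'rV[R]_n) (e : R) : 0 < e ->
  exists B : 'rV[R]_n -> R^o, [/\ smooth setT B, (\near w0, B w0 = 1) &
    forall w, e < `|w - w0| -> B w = 0].
Proof.
move=> e0.
pose q (w : 'rV[R]_n) : R^o :=
  \sum_i (e^-1 * (w 0 i - w0 0 i)) * (e^-1 * (w 0 i - w0 0 i)).
have oT : open [set: 'rV[R]_n] by exact: openT.
have oTR : open [set: R^o] by exact: openT.
have qs k : Cn k setT q.
  apply: (Cn_sum oT) => i.
  have h : Cn k setT (fun w : 'rV[R]_n => e^-1 * (w 0 i - w0 0 i) : R^o).
    apply: (CnM oT (Cn_cst oT k _)).
    exact: (CnD oT (Cn_coord oT i (Cn_id oT k)) (Cn_cst oT k _)).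
  exact: CnM.
(* The value is -1 at w0, hence negative near w0, and at least 1 where q >= 1: these are the two
   ranges on which [smooth_step] is constant. *)
pose p w : R^o := 2 * q w - 1.
have ps k : Cn k setT p.
  exact: (CnD oT (CnM oT (Cn_cst oT k _) (qs k)) (Cn_cst oT k _)).
exists (smooth_step \o p); split=> [k||w ew].
- exact: (Cn_comp_scalar oT oTR _ (ps k) (@smooth_step_smooth k)).
- have cp : {for w0, continuous p} by exact: (ps 0%N).
  have p0 : p w0 = - 1.
    by rewrite /p /q big1 ?mulr0 ?sub0r// => i _; rewrite subrr !mulr0.
  move/cvgrPdist_lt : cp => /(_ 1 ltr01) H.
  near=> w; apply: smooth_step_le0.
  have : `|p w0 - p w| < 1 by near: w; exact: H.
  by rewrite p0 ltr_distlC => /andP[_]; rewrite addNr => /ltW.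
- apply: smooth_step_ge1; rewrite /p.
  suff : 1 <= q w by lra.
  have [i ei] : exists i, e < `|w 0 i - w0 0 i|.
    apply/not_existsP => H; move: ew; rewrite ltNge => /negP; apply.
    rewrite [leLHS]/Num.norm /= mx_normrE; apply/bigmax_leP; split=> [|[j i] _ /=].
      exact: ltW.
    by rewrite !mxE ord1 leNgt; apply/negP; exact: H.
  rewrite /q (bigD1 i)//=.
  apply: (@le_trans _ _ ((e^-1 * (w 0 i - w0 0 i)) * (e^-1 * (w 0 i - w0 0 i)))).
    rewrite -expr2 -real_normK ?num_real// exprn_ege1// normrM ger0_norm.
      by rewrite ler_pdivlMl// mulr1 ltW.
    by rewrite invr_ge0 ltW.
  rewrite lerDl sumr_ge0// => j _; rewrite -expr2; exact: sqr_ge0.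
Unshelve. all: by end_near. Qed.

End Calculus.

(** * Brackets on an atlas *)

Section AtlasCalculus.
Context {R : realType} {T : Type} {n : nat} (A : atlas R T n).
Implicit Types (c : chart A) (U : set T) (p q : T) (f g h : T -> R^o).

(** Openness is read in the charts, since the total space of the dual bundle is used as a bare set
    with an atlas. *)
Definition atlas_open U := forall c : chart A, open (phi c @` (dom c `&` U)).

Lemma atlas_open_dom c : atlas_open (dom c).
Proof. by move=> b; exact: overlap_open. Qed.

Lemma atlas_openT : atlas_open setT.
Proof. by move=> c; rewrite setIT -[dom c]setIid; exact: overlap_open. Qed.

Lemma phi_imageI c U V :
  phi c @` (dom c `&` (U `&` V)) = phi c @` (dom c `&` U) `&` phi c @` (dom c `&` V).
Proof.
apply/seteqP; split=> w; first by move=> [x [cx [Ux Vx]] <-]; split; exists x.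
move=> [[x [cx Ux] xw] [y [cy Vy] yw]]; exists x => //; split=> //; split=> //.
by rewrite -(phiK cx) xw -yw (phiK cy).
Qed.

Lemma atlas_openI U V : atlas_open U -> atlas_open V -> atlas_open (U `&` V).
Proof. by move=> oU oV c; rewrite phi_imageI; apply: openI. Qed.

Lemma smooth_on_sub (W : normedModType R) U V (f : T -> W) :
  U `<=` V -> smooth_on A V f -> smooth_on A U f.
Proof.
move=> UV fs c k; apply: Cn_sub (fs c k) => w [x [cx Ux] <-].
by exists x => //; split=> //; exact: UV.
Qed.

Lemma smooth_on_local (W : normedModType R) U (f : T -> W) :
  (forall p, U p -> exists V (g : T -> W), [/\ atlas_open V, V p, smooth_on A V g &
     forall q, V q -> g q = f q]) -> smooth_on A U f.
Proof.
move=> H c k; apply: Cn_local => _ [p [cp Up] <-].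
have [V [g [oV Vp gs gf]]] := H p Up.
exists (phi c @` (dom c `&` V)); first by exists p.
apply: Cn_ext (gs c k) => // w /phi_psi_id[_ Vw]; exact: gf.
Qed.

Lemma smooth_on_ext (W : normedModType R) U (f g : T -> W) : atlas_open U ->
  (forall q, U q -> f q = g q) -> smooth_on A U f -> smooth_on A U g.
Proof.
by move=> oU fg fs; apply: smooth_on_local => p Up; exists U, f.
Qed.

Lemma smooth_on_cst (W : normedModType R) U (a : W) : atlas_open U ->
  smooth_on A U (fun=> a).
Proof. by move=> oU c k; apply: Cn_cst. Qed.

Lemma smooth_onD (W : normedModType R) U (f g : T -> W) : atlas_open U ->
  smooth_on A U f -> smooth_on A U g -> smooth_on A U (fun x => f x + g x).
Proof. by move=> oU fs gs c k; exact: (CnD (oU c) (fs c k) (gs c k)). Qed.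

Lemma smooth_onM U f g : atlas_open U ->
  smooth_on A U f -> smooth_on A U g -> smooth_on A U (fun x => f x * g x : R^o).
Proof. by move=> oU fs gs c k; exact: (CnM (oU c) (fs c k) (gs c k)). Qed.

Lemma smooth_onN U f : atlas_open U ->
  smooth_on A U f -> smooth_on A U (fun x => - f x : R^o).
Proof.
move=> oU fs; have := smooth_onM oU (smooth_on_cst (-1 : R^o) oU) fs.
by apply: smooth_on_ext => // q _; rewrite mulN1r.
Qed.

Lemma smooth_on_sum (W : normedModType R) U m (f : 'I_m -> T -> W) :
  atlas_open U -> (forall i, smooth_on A U (f i)) ->
  smooth_on A U (fun x => \sum_i f i x).
Proof. by move=> oU fs c k; apply: Cn_sum => // i; exact: fs. Qed.

Lemma smooth_on_row m U (f : T -> 'rV[R]_m) : atlas_open U ->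
  (forall i, smooth_on A U (fun x => f x 0 i : R^o)) -> smooth_on A U f.
Proof. by move=> oU fs c k; apply: Cn_row => // i; exact: fs. Qed.

Lemma smooth_on_entry m U (f : T -> 'rV[R]_m) i : atlas_open U ->
  smooth_on A U f -> smooth_on A U (fun x => f x 0 i : R^o).
Proof. by move=> oU fs c k; exact: (Cn_coord (oU c) i (fs c k)). Qed.

Lemma smooth_on_phi c : smooth_on A (dom c) (phi c).
Proof.
move=> b k; exact: transition_smooth.
Qed.

Lemma smooth_on_comp_phi c (W : set 'rV[R]_n) (B : 'rV[R]_n -> R^o) :
  (forall p, dom c p -> W (phi c p)) -> smooth W B ->
  smooth_on A (dom c) (B \o phi c).
Proof.
move=> cW Bs b k.
refine (Cn_comp1 (@atlas_open_dom c b) _ (@smooth_on_phi c b k) (Bs k)).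
by move=> w /phi_psi_id[_]; exact: cW.
Qed.

Definition smooth_at f p := exists U, [/\ atlas_open U, U p & smooth_on A U f].

Lemma smooth_onP U f p : atlas_open U -> smooth_on A U f -> U p -> smooth_at f p.
Proof. by exists U. Qed.

Lemma smooth_fun_at (f : smooth_fun A) p : smooth_at f p.
Proof. exact: (smooth_onP atlas_openT (sfun_smooth f)). Qed.

Definition eq_at f g p := exists U, [/\ atlas_open U, U p & forall q, U q -> f q = g q].

Lemma smooth_at_cst (a : R^o) p : smooth_at (fun=> a) p.
Proof. by exists setT; split=> //; [exact: atlas_openT|exact/smooth_on_cst/atlas_openT]. Qed.

Lemma smooth_atD f g p : smooth_at f p -> smooth_at g p ->
  smooth_at (fun x => f x + g x) p.
Proof.
move=> [U [oU Up fs]] [V [oV Vp gs]]; exists (U `&` V).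
have oUV := atlas_openI oU oV; split=> //.
by apply: smooth_onD => //; [apply: smooth_on_sub fs|apply: smooth_on_sub gs] => x [].
Qed.

Lemma smooth_atM f g p : smooth_at f p -> smooth_at g p ->
  smooth_at (fun x => f x * g x : R^o) p.
Proof.
move=> [U [oU Up fs]] [V [oV Vp gs]]; exists (U `&` V).
have oUV := atlas_openI oU oV; split=> //.
by apply: smooth_onM => //; [apply: smooth_on_sub fs|apply: smooth_on_sub gs] => x [].
Qed.

Lemma smooth_at_differentiable f p c : dom c p -> smooth_at f p ->
  differentiable (f \o psi c) (phi c p).
Proof. by move=> cp [U [oU Up fs]]; have [+ _] := fs c 1%N; apply; exists p. Qed.

Lemma smooth_at_phi c p i : dom c p -> smooth_at (fun q => phi c q 0 i) p.
Proof.
move=> cp; exists (dom c); split=> //; first exact: atlas_open_dom.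
by apply: smooth_on_entry; [exact: atlas_open_dom|exact: smooth_on_phi].
Qed.

(** The covector df at p in the preferred chart of p. Its entries need not be continuous in p, as
    that chart may change from point to point. *)
Definition grad f p : 'rV[R]_n := \row_i deriv A f p (delta_mx 0 i).

Lemma gradE f p i : grad f p 0 i = deriv A f p (delta_mx 0 i).
Proof. by rewrite mxE. Qed.

Lemma gradP f p (r : 'rV[R]_n) : (forall i, deriv A f p (delta_mx 0 i) = r 0 i) -> grad f p = r.
Proof. by move=> H; apply/rowP => i; rewrite mxE. Qed.

Lemma deriv_grad f p (v : 'rV[R]_n) : deriv A f p v = (v *m (grad f p)^T) 0 0.
Proof.
rewrite mxE; apply: etrans (diff_row _ _ v) _; apply: eq_bigr => i _.
by rewrite mxE [in RHS]mxE.
Qed.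

Definition cform (M : 'M[R]_n) (u v : 'rV[R]_n) : R := (u *m M *m v^T) 0 0.

Lemma cformDl M u u' v : cform M (u + u') v = cform M u v + cform M u' v.
Proof. by rewrite /cform !mulmxDl [LHS]mxE. Qed.

Lemma cformDr M u v v' : cform M u (v + v') = cform M u v + cform M u v'.
Proof. by rewrite /cform linearD mulmxDr [LHS]mxE. Qed.

Lemma cformZl M a u v : cform M (a *: u) v = a * cform M u v.
Proof. by rewrite /cform -!scalemxAl [LHS]mxE. Qed.

Lemma cformZr M a u v : cform M u (a *: v) = a * cform M u v.
Proof. by rewrite /cform linearZ -scalemxAr [LHS]mxE. Qed.

Lemma cformNl M u v : cform M (- u) v = - cform M u v.
Proof. by rewrite -scaleN1r cformZl mulN1r. Qed.

Lemma cformNr M u v : cform M u (- v) = - cform M u v.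
Proof. by rewrite -scaleN1r cformZr mulN1r. Qed.

Lemma cform_suml M m (u : 'I_m -> 'rV[R]_n) v :
  cform M (\sum_i u i) v = \sum_i cform M (u i) v.
Proof. by rewrite /cform !mulmx_suml summxE. Qed.

Lemma cform_sumr M m u (v : 'I_m -> 'rV[R]_n) :
  cform M u (\sum_i v i) = \sum_i cform M u (v i).
Proof. by rewrite /cform linear_sum mulmx_sumr summxE. Qed.

Lemma cform_delta M i j : cform M (delta_mx 0 i) (delta_mx 0 j) = M i j.
Proof. by rewrite /cform -rowE trmx_delta -colE !mxE. Qed.

Lemma cform_tr M u v : cform M^T u v = cform M v u.
Proof.
rewrite /cform; have <- : (v *m M *m u^T)^T = u *m M^T *m v^T.
  by rewrite !trmx_mul trmxK mulmxA.
by rewrite mxE.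
Qed.

Lemma cformN M u v : cform (- M) u v = - cform M u v.
Proof. by rewrite /cform mulmxN mulNmx [LHS]mxE. Qed.

Lemma bracketE (L : T -> 'M[R]_n) f g p :
  bracket A L f g p = cform (L p) (grad f p) (grad g p).
Proof.
rewrite /bracket /cform exchange_big mxE; apply: eq_bigr => j _ /=.
rewrite [X in _ * X]mxE [X in _ * X]mxE [X in X * _]mxE big_distrl.
by apply: eq_bigr => i _ /=; rewrite [X in _ = X * _ * _]mxE [L p i j * _]mulrC.
Qed.

Lemma diff_phi c p i (v : 'rV[R]_n) : dom c p ->
  'd ((fun q => phi c q 0 i : R^o) \o psi c) (phi c p) v = v 0 i.
Proof.
move=> cp.
have lin : linear (fun a : 'rV[R]_n => a 0 i : R^o) by move=> b x y; rewrite !mxE.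
pose l : {linear 'rV[R]_n -> R^o} := HB.pack (fun a : 'rV[R]_n => a 0 i : R^o)
    (GRing.isLinear.Build _ _ _ _ _ lin).
have cl : continuous l by exact: coord_continuous.
have /near_diff : \forall w \near phi c p,
    l w = ((fun q => phi c q 0 i : R^o) \o psi c) w.
  apply: filterS (open_nbhs_nbhs (conj (overlap_open _ c c) _)).
    by move=> w cw /=; rewrite (psiK cw).
  by exists p.
by case; [exact: linear_differentiable|move=> _ ->; rewrite diff_lin].
Qed.

Lemma deriv_chart f p c (a := chart_at A p) (v : 'rV[R]_n) : dom c p -> smooth_at f p ->
  deriv A f p v = 'd (f \o psi c) (phi c p) ('d (phi c \o psi a) (phi a p) v).
Proof.
move=> cp fs; have ap : dom a p by exact: dom_chart_at.
have df := smooth_at_differentiable cp fs.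
have e : phi c p = (phi c \o psi a) (phi a p) by rewrite /= (phiK ap).
apply: etrans _ (diff_comp_at v e (transition_diff ap cp) df).
have near_c : \forall w \near phi a p, (f \o psi a) w =
    ((f \o psi c) \o (phi c \o psi a)) w.
  apply: filterS (open_nbhs_nbhs (conj (overlap_open _ a c) _)).
    by move=> w /phi_psi_id[_ cw] /=; rewrite phiK.
  by exists p.
have [_ E] := near_diff near_c (smooth_at_differentiable ap fs).
exact: (congr1 (fun h : 'rV[R]_n -> R^o => h v) (esym E)).
Qed.

Lemma grad_chart f p c : dom c p -> smooth_at f p ->
  grad f p = \sum_i 'd (f \o psi c) (phi c p) (delta_mx 0 i) *:
    grad (fun q => phi c q 0 i) p.
Proof.
move=> cp fs; apply: gradP => j; rewrite (deriv_chart _ cp fs) diff_row summxE.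
apply: eq_bigr => i _; rewrite [RHS]mxE [X in _ = _ * X]mxE
  (deriv_chart _ cp (smooth_at_phi i cp)).
rewrite mulrC; exact: (congr1 (fun z : R => z * _) (esym (diff_phi i _ cp))).
Qed.

Lemma grad_phi_chart_at p i :
  grad (fun q => phi (chart_at A p) q 0 i) p = delta_mx 0 i.
Proof.
by apply: gradP => j; rewrite /deriv diff_phi ?mxE 1?eq_sym//; exact: dom_chart_at.
Qed.

Lemma grad_eq f g p : eq_at f g p -> smooth_at f p -> grad f p = grad g p.
Proof.
move=> [U [oU Up fg]] fs; have ap := dom_chart_at A p; apply: gradP => i.
rewrite [RHS]mxE.
have near_fg : \forall w \near phi (chart_at A p) p,
    (f \o psi (chart_at A p)) w = (g \o psi (chart_at A p)) w.
  apply: filterS (open_nbhs_nbhs (conj (oU (chart_at A p)) _)).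
    by move=> w /phi_psi_id[_ Uw] /=; rewrite fg.
  by exists p.
have [_ E] := near_diff near_fg (smooth_at_differentiable ap fs).
exact: (congr1 (fun h : 'rV[R]_n -> R^o => h _) (esym E)).
Qed.

Lemma deriv_cst (a : R^o) p v : deriv A (fun=> a) p v = 0.
Proof.
exact: (congr1 (fun h : 'rV[R]_n -> R^o => h v) (diff_cst a (phi (chart_at A p) p))).
Qed.

Lemma derivD f g p v : smooth_at f p -> smooth_at g p ->
  deriv A (fun x => f x + g x) p v = deriv A f p v + deriv A g p v.
Proof.
move=> fs gs; have ap := dom_chart_at A p.
have E := diffD (smooth_at_differentiable ap fs) (smooth_at_differentiable ap gs).
rewrite /deriv; change ((fun x => f x + g x) \o psi (chart_at A p)) with
  ((f \o psi (chart_at A p)) + (g \o psi (chart_at A p))).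
have Ev := congr1 (fun h : 'rV[R]_n -> R^o => h v) E.
exact Ev.
Qed.

Lemma derivM f g p v : smooth_at f p -> smooth_at g p ->
  deriv A (fun x => f x * g x : R^o) p v = f p * deriv A g p v + g p * deriv A f p v.
Proof.
move=> fs gs; have ap := dom_chart_at A p.
have E := diffM (smooth_at_differentiable ap fs) (smooth_at_differentiable ap gs).
rewrite /deriv; change ((fun x => f x * g x : R^o) \o psi (chart_at A p)) with
  ((f \o psi (chart_at A p)) * (g \o psi (chart_at A p))).
have Ev := congr1 (fun h : 'rV[R]_n -> R^o => h v) E.
rewrite -[f p](congr1 f (phiK ap)) -[g p](congr1 g (phiK ap)).
exact Ev.
Qed.

Lemma grad_cst (a : R^o) p : grad (fun=> a) p = 0.
Proof. by apply: gradP => i; rewrite deriv_cst mxE. Qed.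

Lemma gradD f g p : smooth_at f p -> smooth_at g p ->
  grad (fun x => f x + g x) p = grad f p + grad g p.
Proof.
move=> fs gs; apply: gradP => i.
by rewrite derivD// [RHS]mxE [X in _ = X + _]mxE [X in _ = _ + X]mxE.
Qed.

Lemma gradM f g p : smooth_at f p -> smooth_at g p ->
  grad (fun x => f x * g x : R^o) p = f p *: grad g p + g p *: grad f p.
Proof.
move=> fs gs; apply: gradP => i; rewrite derivM// [RHS]mxE.
by rewrite [X in _ = X + _]mxE [X in _ = _ + X]mxE [X in _ = _ * X + _]mxE [X in _ = _ + _ * X]mxE.
Qed.

Lemma grad_sum m (f : 'I_m -> T -> R^o) p : (forall i, smooth_at (f i) p) ->
  smooth_at (fun x => \sum_i f i x) p /\
  grad (fun x => \sum_i f i x) p = \sum_i grad (f i) p.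
Proof.
elim: m f => [|m IH] f fs.
  have -> : (fun x => \sum_(i < 0) f i x) = (fun=> 0 : R^o).
    by apply/funext => x; rewrite big_ord0.
  by rewrite grad_cst big_ord0; split=> //; exact: smooth_at_cst.
have -> : (fun x => \sum_(i < m.+1) f i x) =
    (fun x => f ord0 x + \sum_i f (lift ord0 i) x).
  by apply/funext => x; rewrite big_ord_recl.
have [s E] := IH (fun i => f (lift ord0 i)) (fun i => fs _).
by rewrite gradD// E big_ord_recl; split=> //; exact: smooth_atD.
Qed.

Lemma gradZ (a : R) f p : smooth_at f p -> grad (fun x => a * f x : R^o) p = a *: grad f p.
Proof.
move=> fs; rewrite (gradM (smooth_at_cst _ _) fs) grad_cst scaler0 addr0//.
Qed.

Lemma gradB f g p : smooth_at f p -> smooth_at g p ->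
  grad (fun x => f x - g x : R^o) p = grad f p - grad g p.
Proof.
move=> fs gs; have gs' := smooth_atM (smooth_at_cst (-1) p) gs.
rewrite -scaleN1r -(gradZ _ gs) -(gradD fs gs').
by congr grad; apply/funext => x; rewrite mulN1r.
Qed.

Lemma bracket_eq L f f' g g' p : grad f p = grad f' p -> grad g p = grad g' p ->
  bracket A L f g p = bracket A L f' g' p.
Proof. by rewrite !bracketE => -> ->. Qed.

Lemma bracketDl L f g h p : smooth_at f p -> smooth_at g p ->
  bracket A L (fun x => f x + g x) h p = bracket A L f h p + bracket A L g h p.
Proof. by move=> fs gs; rewrite !bracketE gradD// cformDl. Qed.

Lemma bracketDr L f g h p : smooth_at f p -> smooth_at g p ->
  bracket A L h (fun x => f x + g x) p = bracket A L h f p + bracket A L h g p.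
Proof. by move=> fs gs; rewrite !bracketE gradD// cformDr. Qed.

Lemma bracketBl L f g h p : smooth_at f p -> smooth_at g p ->
  bracket A L (fun x => f x - g x : R^o) h p = bracket A L f h p - bracket A L g h p.
Proof.
by move=> fs gs; rewrite [LHS]bracketE (gradB fs gs) cformDl cformNl -!bracketE.
Qed.

Lemma bracketBr L f g h p : smooth_at f p -> smooth_at g p ->
  bracket A L h (fun x => f x - g x : R^o) p = bracket A L h f p - bracket A L h g p.
Proof.
by move=> fs gs; rewrite [LHS]bracketE (gradB fs gs) cformDr cformNr -!bracketE.
Qed.

Lemma bracketMl L f g h p : smooth_at f p -> smooth_at g p ->
  bracket A L (fun x => f x * g x : R^o) h p =
  f p * bracket A L g h p + g p * bracket A L f h p.
Proof. by move=> fs gs; rewrite [LHS]bracketE (gradM fs gs) cformDl !cformZl -!bracketE. Qed.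

Lemma bracketMr L f g h p : smooth_at f p -> smooth_at g p ->
  bracket A L h (fun x => f x * g x : R^o) p =
  f p * bracket A L h g p + g p * bracket A L h f p.
Proof.
by move=> fs gs; rewrite [LHS]bracketE (gradM fs gs) cformDr !cformZr -!bracketE.
Qed.

Lemma bracket_cstl L (a : R) f g p : smooth_at f p ->
  bracket A L (fun x => a * f x : R^o) g p = a * bracket A L f g p.
Proof. by move=> fs; rewrite !bracketE gradZ// cformZl. Qed.

Lemma bracket_cstr L (a : R) f g p : smooth_at f p ->
  bracket A L g (fun x => a * f x : R^o) p = a * bracket A L g f p.
Proof. by move=> fs; rewrite !bracketE gradZ// cformZr. Qed.

Lemma bracket_chart L f g p c : dom c p -> smooth_at f p -> smooth_at g p ->
  bracket A L f g p = \sum_i \sum_j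
    'd (f \o psi c) (phi c p) (delta_mx 0 i) *
    'd (g \o psi c) (phi c p) (delta_mx 0 j) *
    bracket A L (fun q => phi c q 0 i) (fun q => phi c q 0 j) p.
Proof.
move=> cp fs gs; rewrite bracketE (grad_chart cp fs) (grad_chart cp gs).
rewrite cform_suml; apply: eq_bigr => i _; rewrite cform_sumr; apply: eq_bigr => j _.
by rewrite bracketE cformZl cformZr mulrA.
Qed.

(** In a fixed chart c, instead of the varying preferred ones, the bracket is a sum of products of
    partial derivatives with the components {x_i, x_j}, whose smoothness is part of the data of a
    tensor field. *)
Lemma bracket_smooth (L : tensor2 A) U f g : atlas_open U ->
  smooth_on A U f -> smooth_on A U g -> smooth_on A U (bracket A L f g).
Proof.
move=> oU fs gs c k.
have d h : smooth_on A U h -> forall i,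
    Cn k (phi c @` (dom c `&` U)) (fun w => 'd (h \o psi c) w (delta_mx 0 i)).
  by move=> hs i; have [_ ] := hs c k.+1; apply.
have sub : phi c @` (dom c `&` U) `<=` phi c @` (dom c `&` dom c).
  by move=> w [x [cx Ux] <-]; exists x.
apply: Cn_ext (Cn_sum (oU c) (fun i => Cn_sum (oU c) (fun j =>
  CnM (oU c) (CnM (oU c) (d f fs i) (d g gs j))
    (Cn_sub sub (@tens_smooth _ _ _ _ L c i j c k))))); first exact: oU.
move=> w Uw; have [cw Uw'] := phi_psi_id Uw; symmetry.
rewrite /= (bracket_chart _ cw (smooth_onP oU fs Uw') (smooth_onP oU gs Uw')).
by rewrite (psiK Uw).
Qed.

Lemma bracket_smooth_at (L : tensor2 A) f g p : smooth_at f p -> smooth_at g p ->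
  smooth_at (bracket A L f g) p.
Proof.
move=> [U [oU Up fs]] [V [oV Vp gs]]; exists (U `&` V).
have oUV := atlas_openI oU oV; split=> //; apply: bracket_smooth => //.
  by apply: smooth_on_sub fs => x [].
by apply: smooth_on_sub gs => x [].
Qed.

Definition bracket_fun (L : tensor2 A) (f g : smooth_fun A) : smooth_fun A :=
  SmoothFun (bracket_smooth L atlas_openT (sfun_smooth f) (sfun_smooth g)).

End AtlasCalculus.

(** Where all F_j vanish, the product rule loses the terms with derivatives of K_j. It serves for
    {h, f}, written as a sum of K_j times the partial derivatives of f, at a critical point of f. *)
Lemma diff_sumM {R : realType} (V : normedModType R) m (K F : 'I_m -> V -> R^o) (x v : V) :
  (forall j, differentiable (K j) x) -> (forall j, differentiable (F j) x) ->
  (forall j, F j x = 0) ->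
  differentiable (fun w => \sum_j K j w * F j w : R^o) x /\
  'd (fun w => \sum_j K j w * F j w : R^o) x v = \sum_j K j x * 'd (F j) x v.
Proof.
elim: m K F => [|m IH] K F dK dF F0.
  have -> : (fun w => \sum_(j < 0) K j w * F j w : R^o) = cst 0.
    by apply/funext => w; rewrite big_ord0.
  by rewrite big_ord0; split; [exact: differentiable_cst|rewrite diff_cst].
have -> : (fun w => \sum_(j < m.+1) K j w * F j w : R^o) = K ord0 * F ord0 +
    (fun w => \sum_j K (lift ord0 j) w * F (lift ord0 j) w : R^o).
  by apply/funext => w; rewrite big_ord_recl.
have [d2 E2] := IH _ _ (fun j => dK (lift ord0 j)) (fun j => dF (lift ord0 j))
  (fun j => F0 (lift ord0 j)).
have d1 := differentiableM (dK ord0) (dF ord0).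
split; first exact: differentiableD.
rewrite big_ord_recl -E2; apply: etrans
  (congr1 (fun h : V -> R^o => h v) (diffD d1 d2)) _.
congr (_ + _); apply: etrans
  (congr1 (fun h : V -> R^o => h v) (diffM (dK ord0) (dF ord0))) _.
by rewrite /= F0; apply: etrans (congr1 (+%R _) (scale0r _)) _; rewrite addr0.
Qed.

(** * The Jacobiator of a skew tensor *)

Section Jacobiator.
Context {R : realType} {T : Type} {n : nat} (A : atlas R T n).
Implicit Types (p q : T) (f g h : smooth_fun A) (L : tensor2 A).

Definition jacobiator L f g h p : R :=
  bracket A L f (bracket A L g h) p + bracket A L g (bracket A L h f) p
  + bracket A L h (bracket A L f g) p.

Lemma jacobiator_cycle L f g h p : jacobiator L f g h p = jacobiator L g h f p.
Proof.
rewrite /jacobiator; move: (bracket A L f _ p) (bracket A L g _ p) (bracket A L h _ p).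
by move=> a b c; rewrite -addrA addrC.
Qed.

Lemma smooth_fun_sub_smooth f g : smooth_on A setT (fun x => f x - g x : R^o).
Proof.
have oT := @atlas_openT _ _ _ A.
exact: (smooth_onD oT (sfun_smooth f) (smooth_onN oT (sfun_smooth g))).
Qed.

Definition smooth_fun_sub f g : smooth_fun A := SmoothFun (smooth_fun_sub_smooth f g).

(** Second derivatives in the preferred chart. They have an invariant meaning at critical points of
    f, which is where they are used. *)
Definition hess (f : T -> R^o) p : 'M[R]_n :=
  \matrix_(j, l) 'd (fun w => 'd (f \o psi (chart_at A p)) w (delta_mx 0 j))
    (phi (chart_at A p) p) (delta_mx 0 l).

Lemma hess_sym f p : (hess f p)^T = hess f p.
Proof.
apply/matrixP => j l; rewrite !mxE.
have oO := @atlas_openT _ _ _ A (chart_at A p).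
apply: (diff_comm _ _ oO) (sfun_smooth f (chart_at A p) 2%N).
by exists p => //; split=> //; exact: dom_chart_at.
Qed.

Lemma tens_chart_at L p i j :
  bracket A L (fun q => phi (chart_at A p) q 0 i) (fun q => phi (chart_at A p) q 0 j) p
  = L p i j.
Proof.
by rewrite bracketE !grad_phi_chart_at cform_delta.
Qed.

Lemma skew_bracket L f g p : skew_tensor L -> bracket A L f g p = - bracket A L g f p.
Proof.
move=> sL; rewrite [LHS]bracketE -cform_tr sL cformN; congr (- _).
by rewrite -bracketE.
Qed.

(* At a critical point of [f], only the derivatives of [df] contribute to the
   differential of [{h, f}]. *)
Lemma grad_bracket_critical L f h p : grad A f p = 0 ->
  grad A (bracket A L h f) p = grad A h p *m L p *m hess f p.
Proof.
move=> df0; set a := chart_at A p; have ap : dom a p by exact: dom_chart_at.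
have sb := bracket_smooth_at L (smooth_fun_at h p) (smooth_fun_at f p).
set O := phi a @` (dom a `&` setT).
have oO : open O by exact: (@atlas_openT _ _ _ A a).
have Op : O (phi a p) by exists p.
pose F j w : R^o := 'd (f \o psi a) w (delta_mx 0 j).
pose K j w : R^o := \sum_i 'd (h \o psi a) w (delta_mx 0 i) *
  bracket A L (fun q => phi a q 0 i) (fun q => phi a q 0 j) (psi a w).
have dF j : differentiable (F j) (phi a p).
  have [_ /(_ (delta_mx 0 j))[+ _]] := sfun_smooth f a 2%N; exact.
have dK j : differentiable (K j) (phi a p).
  suff [+ _] : Cn 1 O (K j) by exact.
  apply: (Cn_sum oO) => i; apply: (CnM oO).
    by have [_ ] := sfun_smooth h a 2%N; exact.
  apply: Cn_sub (@tens_smooth _ _ _ _ L a i j a 1%N) => w [x [cx Ux] <-].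
  by exists x.
have F0 j : F j (phi a p) = 0.
  by have := congr1 (fun r : 'rV_n => r 0 j) df0; rewrite [LHS]mxE mxE.
apply: gradP => l; rewrite /deriv -/a.
have nE : \forall w \near phi a p,
    (fun w => \sum_j K j w * F j w : R^o) w = (bracket A L h f \o psi a) w.
  apply: filterS (open_nbhs_nbhs (conj oO _)); last by exists p.
  move=> w Ow; have [cw _] := phi_psi_id Ow.
  rewrite /= (bracket_chart _ cw (smooth_fun_at h _) (smooth_fun_at f _)) (psiK Ow).
  rewrite exchange_big; apply: eq_bigr => j _ /=; rewrite big_distrl.
  by apply: eq_bigr => i _ /=; rewrite mulrAC.
have [dS ES] := diff_sumM (delta_mx 0 l) dK dF F0.
have [_ E] := near_diff nE dS.
apply: etrans (congr1 (fun h : 'rV[R]_n -> R^o => h (delta_mx 0 l)) E) _.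
rewrite ES [RHS]mxE; apply: eq_bigr => j _; rewrite [X in _ = X * _]mxE [X in _ = _ * X]mxE.
congr (_ * _); rewrite /K; apply: eq_bigr => i _.
by rewrite (phiK ap) tens_chart_at [X in _ = X * _]mxE.
Qed.

(** With S the Hessian of f, the two terms that survive are, up to sign, values at (dg, dh) of the
    symmetric form L S L^T. Skewness of L, which turns {f, g} into -{g, f}, gives them opposite
    signs. *)
Lemma jacobiator_critical L f g h p : skew_tensor L -> grad A f p = 0 ->
  jacobiator L f g h p = 0.
Proof.
move=> sL df0; have E2 : bracket A L f g = (fun x => -1 * bracket A L g f x : R^o).
  by apply/funext => x; rewrite skew_bracket// mulN1r.
have T1 : bracket A L f (bracket A L g h) p = 0.
  by rewrite bracketE df0 -(scale0r (0 : 'rV[R]_n)) cformZl mul0r.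
have T2 : bracket A L g (bracket A L h f) p =
    cform (L p) (grad A g p) (grad A h p *m L p *m hess f p).
  by rewrite -grad_bracket_critical// -bracketE.
have T3 : bracket A L h (bracket A L f g) p =
    - cform (L p) (grad A h p) (grad A g p *m L p *m hess f p).
  rewrite E2 bracket_cstr; last first.
    exact: (bracket_smooth_at L (smooth_fun_at g p) (smooth_fun_at f p)).
  by rewrite -grad_bracket_critical// mulN1r -bracketE.
rewrite /jacobiator T1 T2 T3 add0r; apply/eqP; rewrite subr_eq0; apply/eqP.
move: (sL p) (hess_sym f p); set l := L p; set s := hess f p.
move: (grad A g p) (grad A h p) => u v sl ss.
rewrite -cform_tr /cform; congr (_ 0 0).
by rewrite !trmx_mul ss !mulmxA.
Qed.

(** The Jacobiator is additive in f, and f - f' is critical at p. *)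
Lemma jacobiator_eq1 L f f' g h p : skew_tensor L -> grad A f p = grad A f' p ->
  jacobiator L f g h p = jacobiator L f' g h p.
Proof.
move=> sL ff'; apply/eqP; rewrite -subr_eq0; apply/eqP.
pose d := smooth_fun_sub f f'.
have E1 : bracket A L h d = (fun x => bracket A L h f x - bracket A L h f' x : R^o).
  apply/funext => q.
  exact: (bracketBr L h (smooth_fun_at f q) (smooth_fun_at f' q)).
have E2 : bracket A L d g = (fun x => bracket A L f g x - bracket A L f' g x : R^o).
  apply/funext => q.
  exact: (bracketBl L g (smooth_fun_at f q) (smooth_fun_at f' q)).
have sb (u v : smooth_fun A) := bracket_smooth_at L (smooth_fun_at u p) (smooth_fun_at v p).
have <- : jacobiator L d g h p = jacobiator L f g h p - jacobiator L f' g h p.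
  rewrite /jacobiator E1 E2 (bracketBr L g (sb h f) (sb h f')).
  rewrite (bracketBr L h (sb f g) (sb f' g)).
  rewrite (bracketBl L (bracket A L g h) (smooth_fun_at f p) (smooth_fun_at f' p)).
  have alg (a a' b b' c c' : R) :
    (a - a') + (b - b') + (c - c') = a + b + c - (a' + b' + c') by ring.
  exact: alg.
apply: (jacobiator_critical _ _ sL).
by apply: etrans (gradB (smooth_fun_at f p) (smooth_fun_at f' p)) _; rewrite ff' subrr.
Qed.

Lemma jacobiator_eq L f f' g g' h h' p : skew_tensor L -> grad A f p = grad A f' p ->
  grad A g p = grad A g' p -> grad A h p = grad A h' p ->
  jacobiator L f g h p = jacobiator L f' g' h' p.
Proof.
move=> sL ff' gg' hh'; rewrite (jacobiator_eq1 _ _ sL ff').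
rewrite [LHS]jacobiator_cycle (jacobiator_eq1 _ _ sL gg').
by rewrite [LHS]jacobiator_cycle (jacobiator_eq1 _ _ sL hh') [LHS]jacobiator_cycle.
Qed.

End Jacobiator.

(** * Extension of local functions and sections *)

Section Manifold.
Context {R : realType} {M : manifold R}.
Local Notation A := (matlas M).
Local Notation n := (mdim M).

Lemma manifold_open (U : set M) : open U -> atlas_open A U.
Proof. by move/open_atlasE. Qed.

Lemma open_dom (c : chart A) : open (dom c).
Proof. by apply/open_atlasE; exact: atlas_open_dom. Qed.

Lemma open_phi_preimage (c : chart A) (O : set 'rV[R]_n) : open O ->
  open (dom c `&` phi c @^-1` O).
Proof.
move=> oO; apply/open_atlasE => b; rewrite openE => _ [x [bx [cx Ox]] <-].
have oW := overlap_open _ b c.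
have Wx : (phi b @` (dom b `&` dom c)) (phi b x) by exists x.
have cont := transition_smooth _ b c 0%N (phi b x) Wx.
have nO : \forall w \near phi b x, O ((phi c \o psi b) w).
  by apply: cont; apply: open_nbhs_nbhs; split=> //=; rewrite phiK.
have nW : \forall w \near phi b x, (phi b @` (dom b `&` dom c)) w.
  exact: open_nbhs_nbhs.
apply: filterS2 nO nW => w Ow [y [byy cy] yw]; exists y => //; split=> //; split=> //=.
by rewrite -yw /= phiK in Ow.
Qed.

Lemma psi_compact (c : chart A) (C : set 'rV[R]_n) :
  C `<=` phi c @` (dom c `&` setT) -> compact C -> compact (psi c @` C).
Proof.
move=> Cc; apply: continuous_compact; apply: continuous_in_subspaceT => w.
rewrite inE => /Cc[x [cx _] <-] O.
rewrite (phiK cx) nbhsE; case=> O' [oO' O'x] sO.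
have := @image_open _ _ c _ oO' => oi.
have : nbhs (phi c x) (phi c @` (dom c `&` O')) by apply: open_nbhs_nbhs; split=> //; exists x.
apply: filterS => _ [y [cy O'y] <-] /=; rewrite (phiK cy); exact: sO.
Qed.

(** A bump in a chart is continued by 0 outside the chart domain. The result is smooth because it
    vanishes off K, the image of a closed ball, which is compact and hence, M being Hausdorff,
    closed in M. [K] is returned along with [chi] so that products with [chi] can be continued by 0
    in the same way. *)
Lemma manifold_bump (x : M) (U : set M) : open U -> U x ->
  exists (chi : smooth_fun A) (V K : set M),
  [/\ open V, V x, forall y, V y -> chi y = 1, closed K & K `<=` U /\
      forall y, ~ K y -> chi y = 0].
Proof.
move=> oU Ux; pose c := chart_at A x; have cx : dom c x by exact: dom_chart_at.
have : nbhs (phi c x) (phi c @` (dom c `&` U)).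
  by apply: open_nbhs_nbhs; split; [exact: image_open|exists x].
case/nbhs_ballP => d /= d0 dU.
(* Half the radius, so that even the closed ball lies in the image of U. *)
have e0 : 0 < d / 2 by rewrite divr_gt0.
have [B [Bs B1 B0]] := @bump_rV _ _ (phi c x) _ e0.
pose C := closed_ball (phi c x) (d / 2).
have CU : C `<=` phi c @` (dom c `&` U).
  rewrite /C closed_ballE// => w /= xw; apply: dU; rewrite -ball_normE /=.
  by apply: le_lt_trans xw _; rewrite ltr_pdivrMr// mulr_natr mulr2n ltrDl.
have cC : compact C.
  apply: bounded_closed_compact; last exact: closed_ball_closed.
  exists (`|phi c x| + d / 2); split; first exact: num_real.
  move=> r hr w; rewrite /C closed_ballE// => xw; apply: ltW; apply: le_lt_trans hr.
  rewrite -[w in `|w|](subKr (phi c x)); apply: le_trans (ler_normB _ _) _.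
  by rewrite lerD2l.
pose K := psi c @` C.
have cK : closed K.
  apply: compact_closed; first exact: space_hausdorff.
  by apply: psi_compact => // w /CU [y [cy _] <-]; exists y.
have chi0 q : ~ K q -> dom c q -> B (phi c q) = 0.
  move=> nK cq; apply: B0; rewrite ltNge; apply/negP => h; apply: nK.
  by exists (phi c q); [rewrite /C closed_ballE//= /closed_ball_ /= distrC|exact: phiK].
pose chi y : R^o := if `[< dom c y >] then B (phi c y) else 0.
have chis : smooth_on A setT chi.
  apply: smooth_on_local => p _; case: (pselect (dom c p)) => cp.
    exists (dom c), (B \o phi c); split=> //; first exact: atlas_open_dom.
      exact: (smooth_on_comp_phi (W := setT)).
    by move=> q cq; rewrite /chi asboolT.
  exists (~` K), (fun=> 0); split.
  - by apply: manifold_open; exact: closed_openC.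
  - by move=> [w /CU[y [cy _] <-]]; rewrite (phiK cy) => yp; apply: cp; rewrite -yp.
  - by apply: smooth_on_cst; apply: manifold_open; exact: closed_openC.
  - move=> q nK; rewrite /chi; case: asboolP => // cq; by rewrite chi0.
have B1' : nbhs (phi c x) [set w | B w = 1] by exact: B1.
move: B1'; rewrite nbhsE; case=> O [oO Ox] OB.
exists (SmoothFun chis), (dom c `&` phi c @^-1` O), K; split=> //.
- exact: open_phi_preimage.
- by move=> y [cy /OB Oy]; rewrite /= /chi asboolT.
- split=> [_ [w Cw <-]|y nK /=].
    by have [y [cy Uy] <-] := CU w Cw; rewrite phiK.
  by rewrite /chi; case: asboolP => // cq; rewrite chi0.
Qed.

(** Only the germ at x can be kept, as h may blow up at the boundary of U. *)
Lemma smooth_extension (h : M -> R^o) (U : set M) (x : M) : open U -> U x ->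
  smooth_on A U h -> exists f : smooth_fun A, eq_at A f h x.
Proof.
move=> oU Ux hs; have [chi [V [K [oV Vx chi1 cK [KU chi0]]]]] := manifold_bump oU Ux.
have fs : smooth_on A setT (fun y => chi y * (if `[< U y >] then h y else 0) : R^o).
  apply: smooth_on_local => p _; case: (pselect (U p)) => Up.
    exists U, (fun y => chi y * h y : R^o); split=> //; first exact: manifold_open.
      apply: smooth_onM => //; first exact: manifold_open.
      by apply: smooth_on_sub (sfun_smooth chi).
    by move=> q Uq; rewrite asboolT.
  exists (~` K), (fun=> 0); split.
  - by apply: manifold_open; exact: closed_openC.
  - by move/KU.
  - by apply: smooth_on_cst; apply: manifold_open; exact: closed_openC.
  - by move=> q nK; rewrite chi0// mul0r.
exists (SmoothFun fs), (V `&` U); split=> //.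
  by apply: manifold_open; exact: openI.
by move=> q [Vq Uq] /=; rewrite chi1// mul1r asboolT.
Qed.

End Manifold.

(** * Global sections with a prescribed germ *)

Section Sections.
Context {R : realType} {M : manifold R} (E : vbundle M).
Local Notation A := (matlas M).
Local Notation r := (rank E).

Lemma Gamma_ext (X Y : Gamma E) : (forall x, X x = Y x) -> X = Y.
Proof.
case: X Y => [X Xs] [Y Ys] /= XY; have e : X = Y by apply: functional_extensionality_dep.
by move: Xs; rewrite e => Xs; congr MkGamma; exact: Prop_irrelevance.
Qed.

Lemma untriv_delta (i : tix E) (x : M) (u : 'rV[R]_r) :
  untriv i x u = \sum_m u 0 m *: untriv i x (delta_mx 0 m).
Proof.
rewrite [in LHS](row_sum_delta u) linear_sum; apply: eq_bigr => m _.
by rewrite linearZ.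
Qed.

Lemma smooth_on_scale m (U : set M) (f : M -> R^o) (g : M -> 'rV[R]_m) :
  atlas_open A U -> smooth_on A U f -> smooth_on A U g ->
  smooth_on A U (fun x => f x *: g x).
Proof.
move=> oU fs gs; apply: smooth_on_row => // i.
apply: (smooth_on_ext oU) (smooth_onM oU fs (smooth_on_entry i oU gs)).
by move=> q _; rewrite mxE.
Qed.

Lemma section_extension (i : tix E) (h : M -> 'rV[R]_r) (U : set M) (x : M) :
  open U -> U x -> U `<=` tdom i -> smooth_on A U h ->
  exists (X : Gamma E) (V : set M), [/\ open V, V x, V `<=` U &
    forall y, V y -> triv i y (X y) = h y].
Proof.
move=> oU Ux Ui hs; have [chi [V [K [oV Vx chi1 cK [KU chi0]]]]] := manifold_bump oU Ux.
have Xs (j : tix E) : smooth_on A (tdom j)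
    (fun y => triv j y (chi y *: untriv i y (h y))).
  apply: smooth_on_local => p jp; case: (pselect (U p)) => Up.
    have oj : atlas_open A (tdom j `&` U).
      by apply: manifold_open; apply: openI => //; exact: tdom_open.
    (* Transition maps are known to be smooth on constant vectors, so the section is expanded in the
       frame of i before passing to the trivialization j. *)
    exists (tdom j `&` U), (fun y => \sum_m (chi y * h y 0 m) *:
      triv j y (untriv i y (delta_mx 0 m))); split=> //.
      apply: smooth_on_sum => // m; apply: smooth_on_scale => //.
        apply: smooth_onM => //; first exact: smooth_on_sub (sfun_smooth chi).
        apply: smooth_on_entry => //.
        by apply: smooth_on_sub hs => y [].
      apply: smooth_on_sub (@triv_smooth _ _ E i j (delta_mx 0 m)) => y [jy Uy].
      by split=> //; exact: Ui.
    move=> q _; rewrite [in RHS](untriv_delta i q (h q)) [RHS]linearZ /= linear_sum scaler_sumr.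
    by apply: eq_bigr => m _; rewrite linearZ; exact: esym (scalerA _ _ _).
  have oK : atlas_open A (~` K) by apply: manifold_open; exact: closed_openC.
  exists (~` K), (fun=> 0); split=> //.
  - by move/KU.
  - exact: smooth_on_cst.
  - by move=> q nK; rewrite chi0// scale0r linear0.
exists (MkGamma Xs), (V `&` U); split=> //; first exact: openI.
by move=> y [Vy Uy] /=; rewrite chi1// scale1r untrivK//; exact: Ui.
Qed.

Lemma section_at (x : M) (e : E x) : exists X : Gamma E, X x = e.
Proof.
pose i := triv_at E x.
have [|||X [V [oV Vx Vi XE]]] :=
    @section_extension i (fun=> triv i x e) (tdom i) x (tdom_open i).
- exact: tdom_at.
- by [].
- by apply: smooth_on_cst; apply: manifold_open; exact: tdom_open.
exists X; rewrite -[LHS](trivK (Vi _ Vx)) -[RHS](trivK (Vi _ Vx)).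
by rewrite XE.
Qed.

End Sections.

(** * Functions on the dual bundle *)

Section DualSpace.
Context {R : realType} {M : manifold R} (E : vbundle M).
Local Notation A := (matlas M).
Local Notation DA := (dual_atlas E).
Local Notation n := (mdim M).
Local Notation r := (rank E).
Implicit Types (x y : M) (X Y Z : Gamma E) (p q : dual_space E).
Implicit Types (f g : smooth_fun A) (F G : smooth_fun DA).

Definition dpoint x (a : 'Hom(E x, R^o)) : dual_space E :=
  existT (fun x => dual E x) x a.

Lemma image_fibresE (c : chart DA) (U : set M) :
  phi c @` (dom c `&` (@projT1 _ _ @^-1` U)) =
  lsubmx @^-1` (phi c.1 @` (dom c.1 `&` (@tdom _ _ E c.2 `&` U))).
Proof.
case: c => c i; apply/seteqP; split=> w /=.
  by move=> [[x a] [[/= cx ix] Ux] <-]; rewrite /total_phi /= row_mxKl; exists x.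
move=> [x [cx [ix Ux]] xw].
exists (dpoint (@dual_untriv _ _ E i x (rsubmx w))) => //.
by rewrite /total_phi /= dual_untrivK// xw hsubmxK.
Qed.

Lemma dual_atlas_open (U : set M) : open U -> atlas_open DA (@projT1 _ _ @^-1` U).
Proof.
move=> oU c; rewrite image_fibresE; apply: open_comp.
  by move=> w _; exact: continuous_lsubmx.
by apply: image_open; apply: openI => //; exact: tdom_open.
Qed.

Lemma smooth_on_pullback (U : set M) (f : M -> R^o) : open U -> smooth_on A U f ->
  smooth_on DA (@projT1 _ _ @^-1` U) (pullback f).
Proof.
move=> oU fs c k; have oO := @dual_atlas_open U oU c.
have lk : Cn k (phi c @` (dom c `&` (@projT1 _ _ @^-1` U))) (lsubmx : _ -> 'rV[R]_n).
  apply: Cn_row => // m.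
  by apply: Cn_ext (Cn_coord oO (lshift r m) (Cn_id oO k)) => // w _; rewrite mxE.
refine (Cn_comp1 oO _ lk (fs c.1 k)).
rewrite image_fibresE => w [y [cy [iy Uy]] yw].
by exists y.
Qed.

Lemma iotaE X p (i : tix E) : tdom i (projT1 p) ->
  iota X p = \sum_l dual_triv i (projT2 p) 0 l * triv i _ (X (projT1 p)) 0 l.
Proof.
case: p => x a /= ix; rewrite /iota /= -[in LHS](dual_trivK ix a).
by rewrite lfunE.
Qed.

Lemma iota_phi X p (c : chart DA) : tdom c.2 (projT1 p) ->
  iota X p = \sum_l phi c p 0 (rshift n l) *
    pullback (fun y => @triv _ _ E c.2 y (X y) 0 l) p.
Proof.
move=> ip; rewrite (iotaE _ ip); apply: eq_bigr => l _.
by rewrite /= /total_phi row_mxEr.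
Qed.

Lemma iota_smooth X : smooth_on DA setT (iota X).
Proof.
apply: smooth_on_local => p _; pose c : chart DA := total_chart_at p.
have oi : open (@tdom _ _ E c.2 `&` dom c.1).
  by apply: openI; [exact: tdom_open|exact: open_dom].
have od := dual_atlas_open oi.
exists (@projT1 _ _ @^-1` (@tdom _ _ E c.2 `&` dom c.1)), (fun p => \sum_l phi c p 0 (rshift n l) *
    pullback (fun y => @triv _ _ E c.2 y (X y) 0 l) p : R^o); split=> //.
- by split=> /=; [exact: tdom_at|exact: dom_chart_at].
- apply: smooth_on_sum => // l; apply: smooth_onM => //.
    apply: smooth_on_entry => //.
    by apply: smooth_on_sub (@smooth_on_phi _ _ _ DA c) => q [].
  apply: smooth_on_pullback => //; apply: smooth_on_entry; first exact: manifold_open.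
  by apply: smooth_on_sub (@sec_smooth _ _ _ X c.2) => q [].
- by move=> q [iq _]; rewrite (@iota_phi X q c iq).
Qed.

Definition iota_fun X : smooth_fun DA := SmoothFun (iota_smooth X).

Lemma pullback_smooth f : smooth_on DA setT (pullback f).
Proof. exact: (smooth_on_pullback openT (sfun_smooth f)). Qed.

Definition pullback_fun f : smooth_fun DA := SmoothFun (pullback_smooth f).

Lemma iota_smooth_at X p : smooth_at DA (iota X) p.
Proof. exact: (smooth_fun_at (iota_fun X)). Qed.

Lemma pullback_smooth_at (f : M -> R^o) p : smooth_at A f (projT1 p) ->
  smooth_at DA (pullback f) p.
Proof.
move=> [U [oU Up fs]]; exists (@projT1 _ _ @^-1` U); split=> //.
  by apply: dual_atlas_open; apply/open_atlasE.
by apply: smooth_on_pullback => //; apply/open_atlasE.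
Qed.

(** The preferred chart of E* at p is built on the preferred chart of M at the base point, so the
    base components of the two differentials agree literally. *)
Lemma grad_pullback (f : M -> R^o) p : smooth_at A f (projT1 p) ->
  grad DA (pullback f) p = row_mx (grad A f (projT1 p)) 0.
Proof.
move=> fs; apply: gradP => j; case: p fs => x a /= fs.
have lin : linear (lsubmx : 'rV[R]_(n + r) -> 'rV[R]_n).
  by move=> b u v; rewrite linearP.
pose l : {linear 'rV[R]_(n + r) -> 'rV[R]_n} :=
  HB.pack (lsubmx : 'rV[R]_(n + r) -> 'rV[R]_n) (GRing.isLinear.Build _ _ _ _ _ lin).
have cl : continuous l by exact: continuous_lsubmx.
pose c := chart_at A x; have cx : dom c x by exact: dom_chart_at.
pose w := phi (chart_at DA (dpoint a)) (dpoint a).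
have e : phi c x = l w by rewrite /= /w /= /total_phi row_mxKl.
have dl : differentiable l w by exact: linear_differentiable.
have df := smooth_at_differentiable cx fs.
have E1 := @diff_comp_at _ _ _ _ l (f \o psi c) w (phi c x) (delta_mx 0 j) e dl df.
apply: etrans E1 _; rewrite (diff_lin _ cl) /=.
case: (split_ordP j) => j' ->.
  by rewrite row_mxEl gradE; congr ('d _ _ _); rewrite delta_mx_lshift row_mxKl.
by rewrite row_mxEr mxE delta_mx_rshift row_mxKl linear0.
Qed.

(** Product rule for [iota X] as the sum of the xi_l X^l. On the zero section the base part
    vanishes, and the differential depends on X(x) alone. *)
Lemma grad_iota X x (a : 'Hom(E x, R^o)) (i := triv_at E x) :
  grad DA (iota X) (dpoint a) =
  row_mx (\sum_l dual_triv i a 0 l *: grad A (fun y => triv i y (X y) 0 l) x)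
    (triv i x (X x)).
Proof.
pose c := chart_at DA (dpoint a).
have ix : tdom i x by exact: tdom_at.
pose S l q : R^o := phi c q 0 (rshift n l) *
    pullback (fun y => triv i y (X y) 0 l) q.
have sX l : smooth_at A (fun y => triv i y (X y) 0 l) x.
  exists (tdom i); split=> //; first exact: manifold_open (tdom_open i).
  by apply: smooth_on_entry; [exact: manifold_open (tdom_open i)|exact: sec_smooth].
have sp l : smooth_at DA (pullback (fun y => triv i y (X y) 0 l)) (dpoint a).
  exact: pullback_smooth_at.
have sphi l : smooth_at DA (fun q => phi c q 0 (rshift n l)) (dpoint a).
  by apply: smooth_at_phi; exact: dom_chart_at.
have sS l : smooth_at DA (S l) (dpoint a) by exact: smooth_atM.
have [s gE] := grad_sum sS.
have -> : grad DA (iota X) (dpoint a) = grad DA (fun q => \sum_l S l q) (dpoint a).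
  apply: esym; apply: grad_eq => //; exists (@projT1 _ _ @^-1` (tdom i)); split=> //.
    exact: dual_atlas_open (tdom_open i).
  by move=> q iq; rewrite (@iota_phi X q c iq).
rewrite gE; have gS l : grad DA (S l) (dpoint a) =
    row_mx (dual_triv i a 0 l *: grad A (fun y => triv i y (X y) 0 l) x)
      (triv i x (X x) 0 l *: delta_mx 0 l).
  rewrite /S (gradM (sphi l) (sp l)) grad_pullback// grad_phi_chart_at.
  rewrite delta_mx_rshift !scale_row_mx !scaler0 add_row_mx add0r addr0.
  by rewrite /= /total_phi row_mxEr.
rewrite (eq_bigr _ (fun l _ => gS l)).
transitivity (row_mx (\sum_l dual_triv i a 0 l *: grad A (fun y => triv i y (X y) 0 l) x)
  (\sum_l triv i x (X x) 0 l *: (delta_mx 0 l : 'rV[R]_r))).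
  apply/rowP => j; rewrite summxE; case: (split_ordP j) => j' ->.
    by rewrite row_mxEl summxE; apply: eq_bigr => l _; rewrite row_mxEl.
  by rewrite row_mxEr summxE; apply: eq_bigr => l _; rewrite row_mxEr.
by rewrite -row_sum_delta.
Qed.


Lemma iota_add X Y : iota (sec_add X Y) = (fun p => iota X p + iota Y p).
Proof. by apply/funext => p; rewrite /iota linearD. Qed.

Lemma iota_scale f X : iota (sec_scale f X) = (fun p => pullback f p * iota X p).
Proof. by apply/funext => p; rewrite /iota linearZ. Qed.

Lemma smooth_fun_with_grad x (v : 'rV[R]_n) (a : R) :
  exists f, f x = a /\ grad A f x = v.
Proof.
pose c := chart_at A x; have cx : dom c x by exact: dom_chart_at.
pose S j y : R^o := v 0 j * phi c y 0 j.
have sS j : smooth_at A (S j) x.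
  by apply: smooth_atM; [exact: smooth_at_cst|exact: smooth_at_phi].
have [sS' gS] := grad_sum sS.
pose h y : R^o := \sum_j S j y + (a - \sum_j S j x).
have sh : smooth_on A (dom c) h.
  have od := manifold_open (open_dom c).
  apply: smooth_onD => //; last exact: smooth_on_cst.
  apply: smooth_on_sum => // j; apply: smooth_onM => //; first exact: smooth_on_cst.
  by apply: smooth_on_entry => //; exact: smooth_on_phi.
have [f fh] := smooth_extension (open_dom c) cx sh.
exists f; split.
  by have [U [_ Ux ->//]] := fh; rewrite /h addrCA subrr addr0.
rewrite (grad_eq fh (smooth_fun_at f x)) /h (gradD sS' (@smooth_at_cst _ _ _ A _ x)).
rewrite grad_cst addr0 gS [RHS]row_sum_delta; apply: eq_bigr => j _.
by rewrite /S gradZ ?grad_phi_chart_at//; exact: smooth_at_phi.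
Qed.

(** A section with constant components v near x, so that one X serves every a over x. *)
Lemma iota_with_vertical_grad x (v : 'rV[R]_r) :
  exists X, forall a : 'Hom(E x, R^o), grad DA (iota X) (dpoint a) = row_mx 0 v.
Proof.
pose i := triv_at E x; have ix : tdom i x by exact: tdom_at.
have oi := manifold_open (tdom_open i).
have [X [V [oV Vx Vi XE]]] := section_extension (tdom_open i) ix
  (@subset_refl _ _) (smooth_on_cst v oi).
exists X => a; rewrite grad_iota -/i XE//; congr row_mx.
rewrite big1// => l _; rewrite (_ : grad _ _ _ = 0) ?scaler0//.
rewrite -(grad_cst A (v 0 l : R^o) x); apply: esym; apply: grad_eq; last exact: smooth_at_cst.
exists V; split=> //; first exact: manifold_open.
by move=> q Vq; rewrite XE.
Qed.

(** Covers a = 0 as well, where the functions [iota X] have vertical differentials only; a pull-back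
    supplies the base components. *)
Lemma dual_fun_with_grad x (a : 'Hom(E x, R^o)) (v : 'rV[R]_(n + r)) :
  exists F, grad DA F (dpoint a) = v.
Proof.
have [f [_ gf]] := smooth_fun_with_grad x (lsubmx v) 0.
have [X gX] := iota_with_vertical_grad x (rsubmx v).
have sF : smooth_on DA setT (fun p => pullback f p + iota X p : R^o).
  by apply: smooth_onD; [exact: atlas_openT|exact: pullback_smooth|exact: iota_smooth].
exists (SmoothFun sF) => /=.
rewrite (gradD (pullback_smooth_at (smooth_fun_at f _)) (iota_smooth_at X _)).
rewrite gX grad_pullback; last exact: smooth_fun_at.
by rewrite /= gf add_row_mx addr0 add0r hsubmxK.
Qed.

Lemma dual_neq0 x (a : 'Hom(E x, R^o)) : a != 0 -> exists e, a e = 1.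
Proof.
move=> a0; have [e ae] : exists e, a e != 0.
  apply/not_existsP => H; move/negP: a0; apply; apply/eqP/lfunP => e.
  by rewrite zero_lfunE; apply/eqP; move: (H e) => /negP; rewrite negbK.
by exists ((a e)^-1 *: e); rewrite linearZ; exact: mulVf.
Qed.

(* Off the zero section the differentials of the functions [iota X] exhaust the
   cotangent space: d(iota (f X)) = f d(iota X) + iota X d(pi^* f). *)
Lemma iota_with_grad x (a : 'Hom(E x, R^o)) (v : 'rV[R]_(n + r)) : a != 0 ->
  exists X, grad DA (iota X) (dpoint a) = v.
Proof.
move=> /dual_neq0[e ae]; have [Z Ze] := section_at e.
have [f [fx gf]] := smooth_fun_with_grad x (lsubmx v) 0.
have [X gX] := iota_with_vertical_grad x (rsubmx v).
exists (sec_add (sec_scale f Z) X).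
have sf := pullback_smooth_at (smooth_fun_at f (projT1 (dpoint a))).
rewrite iota_add (gradD (iota_smooth_at _ _) (iota_smooth_at X _)) gX iota_scale.
rewrite (gradM sf (iota_smooth_at Z _)) /pullback /= fx scale0r add0r.
rewrite (grad_pullback (p := dpoint a) (smooth_fun_at f _)) /= gf /iota /= Ze ae scale1r.
by rewrite add_row_mx addr0 add0r hsubmxK.
Qed.

(** Positive rank enters here: over every x there is a covector along which the zero covector can be
    approached. *)
Lemma dual_space_inhabited (r0 : (0 < r)%N) x : exists a : 'Hom(E x, R^o), a != 0.
Proof.
pose i := triv_at E x; pose k := Ordinal r0.
exists (dual_untriv i x (delta_mx 0 k)); apply/eqP => H.
have := dual_untrivK (tdom_at E x) (delta_mx 0 k).
rewrite H linear0 => /(congr1 (fun w : 'rV_r => w 0 k)).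
by rewrite [LHS]mxE [RHS]mxE !eqxx => /eqP; rewrite eq_sym oner_eq0.
Qed.

Lemma dual_untriv_delta (i : tix E) x (k : 'I_r) (e : E x) :
  dual_untriv i x (delta_mx 0 k) e = triv i x e 0 k.
Proof.
rewrite lfunE /= /pairing (bigD1 k)//= big1 => [|l lk].
  by rewrite addr0 mxE !eqxx mul1r.
by rewrite mxE (negbTE lk) andbF mul0r.
Qed.

Lemma dual_separates x (e e' : E x) :
  (forall a : 'Hom(E x, R^o), a e = a e') -> e = e'.
Proof.
move=> H; have ix := tdom_at E x.
rewrite -[LHS](trivK ix) -[RHS](trivK ix); apply: congr1; apply/rowP => k.
by have := H (dual_untriv (triv_at E x) x (delta_mx 0 k)); rewrite !dual_untriv_delta.
Qed.

Lemma iota_inj X Y : iota X = iota Y -> X = Y.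
Proof.
move=> XY; apply: Gamma_ext => x; apply: dual_separates => a.
by have : iota X (dpoint a) = iota Y (dpoint a) by rewrite XY.
Qed.

(** With u = 0 this restricts F to the zero section; with u a basis vector it gives the components
    of the section that a fibrewise linear F represents. *)
Lemma smooth_on_frame F (i : tix E) (u : 'rV[R]_r) :
  smooth_on A (tdom i) (fun x => F (dpoint (dual_untriv i x u))).
Proof.
move=> c k; have oO := @image_open _ _ c _ (tdom_open i).
pose d : chart DA := (c, i).
have Ik : Cn k (phi c @` (dom c `&` tdom i)) (fun w => row_mx w u).
  apply: Cn_row => // j; case: (split_ordP j) => j' ->.
    by apply: Cn_ext (Cn_coord oO j' (Cn_id oO k)) => // w _; rewrite row_mxEl.
  by apply: Cn_ext (Cn_cst oO k (u 0 j' : R^o)) => // w _; rewrite row_mxEr.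
apply: Cn_ext (Cn_comp1 oO _ Ik (sfun_smooth F d k)) => //.
  by move=> w _; rewrite /= /total_psi /= row_mxKl row_mxKr.
move=> w [y [cy iy] yw]; exists (dpoint (dual_untriv i y u)) => //.
by rewrite /= /total_phi /= yw dual_untrivK.
Qed.

(** In a chart of E* the ray through a is an affine path over a fixed base point, so continuity of F
    in that chart suffices. *)
Lemma ray_limit F x (a : 'Hom(E x, R^o)) (l : R) :
  (forall t : R, t != 0 -> F (dpoint (t *: a)) = l) ->
  F (dpoint (0 : 'Hom(E x, R^o))) = l.
Proof.
move=> H; pose i := triv_at E x; have ix : tdom i x by exact: tdom_at.
pose d : chart DA := (chart_at A x, i); pose c := chart_at A x.
have cx : dom c x by exact: dom_chart_at.
pose u := dual_triv i a.
pose w (t : R) := row_mx (phi c x) (t *: u).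
have Fw t : F (dpoint (t *: a)) = (F \o psi d) (w t).
  rewrite /= /total_psi /= /w row_mxKl row_mxKr phiK//=; congr (F (existT _ _ _)).
  by rewrite linearZ /= dual_trivK.
have cF : {for w 0, continuous (F \o psi d)}.
  apply: (sfun_smooth F d 0%N); exists (dpoint (0 : 'Hom(E x, R^o))) => //.
  by rewrite /= /total_phi /= linear0 /w scale0r.
have cw : {for (0 : R), continuous w}.
  have -> : w = (fun t => row_mx (phi c x) 0 + t *: row_mx 0 u).
    by apply/funext => t; rewrite scale_row_mx add_row_mx scaler0 addr0 add0r.
  apply: continuousD; first exact: cst_continuous.
  exact: scalel_continuous.
have cFw : {for (0 : R), continuous (F \o psi d \o w)} by exact: continuous_comp.
have -> : dpoint (0 : 'Hom(E x, R^o)) = dpoint (0 *: a) by rewrite scale0r.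
rewrite Fw; apply/eqP; rewrite -subr_eq0 -normr_eq0; apply/negP => /negP n0.
have e0 : 0 < `|(F \o psi d) (w 0) - l| by rewrite lt_def n0 /=.
move/cvgrPdist_lt : cFw => /(_ _ e0) N.
have N' : \forall t \near (0 : R)^', `|(F \o psi d \o w) 0 - (F \o psi d \o w) t|
    < `|(F \o psi d) (w 0) - l| by exact: nbhs_dnbhs.
have : \forall t \near (0 : R)^', False.
  near=> t; have tn0 : t != 0 by near: t; exact: nbhs_dnbhs_neq.
  have : `|(F \o psi d \o w) 0 - (F \o psi d \o w) t|
    < `|(F \o psi d) (w 0) - l| by near: t; exact: N'.
  have -> : (F \o psi d \o w) t = l by rewrite -(H t tn0) Fw.
  by rewrite ltxx.
by move=> /filter_ex[].
Unshelve. all: by end_near. Qed.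

Lemma smooth_dual_eq (r0 : (0 < r)%N) F G :
  (forall x (a : 'Hom(E x, R^o)), a != 0 -> F (dpoint a) = G (dpoint a)) ->
  forall p, F p = G p.
Proof.
move=> FG [x a]; have [->|a0] := eqVneq (a : 'Hom(E x, R^o)) 0; last exact: FG.
have [b b0] := dual_space_inhabited r0 x; apply/eqP; rewrite -subr_eq0; apply/eqP.
apply: (@ray_limit (smooth_fun_sub F G) x b 0) => t t0 /=.
by rewrite FG ?subrr// scaler_eq0 negb_or t0.
Qed.

(** Off the zero section the functions [iota X] supply all pairs of covectors, hence the matrices
    agree. On it the comparison is made for brackets of functions F and G with prescribed
    differentials: these brackets are smooth and already agree off the zero section. *)
Lemma tensor2_eq (r0 : (0 < r)%N) (L L' : tensor2 DA) :
  (forall X Y p, bracket DA L (iota X) (iota Y) p = bracket DA L' (iota X) (iota Y) p) ->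
  forall p, L p = L' p.
Proof.
move=> LL'.
have H x (a : 'Hom(E x, R^o)) : a != 0 -> L (dpoint a) = L' (dpoint a).
  move=> a0; apply/matrixP => i j; rewrite -!cform_delta.
  have [X <-] := iota_with_grad (delta_mx 0 i) a0.
  have [Y <-] := iota_with_grad (delta_mx 0 j) a0.
  by rewrite -!bracketE.
move=> [x a]; apply/matrixP => i j; rewrite -!cform_delta.
have [F <-] := @dual_fun_with_grad x a (delta_mx 0 i).
have [G <-] := @dual_fun_with_grad x a (delta_mx 0 j).
rewrite -!bracketE.
apply: (smooth_dual_eq r0 (F := bracket_fun L F G) (G := bracket_fun L' F G)) => y b b0 /=.
by rewrite !bracketE H.
Qed.

Lemma tensor2_ext (L L' : tensor2 DA) : (forall p, L p = L' p) -> L = L'.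
Proof.
case: L L' => [L Ls] [L' Ls'] /= LL'; have e : L = L' by apply/funext.
by move: Ls; rewrite e => Ls; congr Tensor2; exact: Prop_irrelevance.
Qed.

(** The components of Z(x) are the values of F on the dual basis. Z is defined through the preferred
    trivialization, but the property a(Z(x)) = F(a) does not mention it, so the components in any
    other trivialization are again values of F, and smooth. *)
Lemma fibre_linear_iota F : fibre_linear F -> exists Z, iota Z = F.
Proof.
move=> Fl.
have FE (i : tix E) x (a : 'Hom(E x, R^o)) : tdom i x -> F (dpoint a) =
    \sum_k dual_triv i a 0 k * F (dpoint (dual_untriv i x (delta_mx 0 k))).
  move=> ix.
  pose l : {linear 'Hom(E x, R^o) -> R^o} :=
    HB.pack (fun a : 'Hom(E x, R^o) => F (dpoint a)) (GRing.isLinear.Build _ _ _ _ _ (Fl x)).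
  rewrite -[LHS]/(l a) -(dual_trivK ix a) {1}(row_sum_delta (dual_triv i a)).
  rewrite !linear_sum; apply: eq_bigr => k _; rewrite linearZ linearZ /=.
  by rewrite dual_trivK.
pose z (i : tix E) x : 'rV[R]_r := \row_k F (dpoint (dual_untriv i x (delta_mx 0 k))).
pose Z x : E x := untriv (triv_at E x) x (z (triv_at E x) x).
have aZ x (a : 'Hom(E x, R^o)) : a (Z x) = F (dpoint a).
  have ix := tdom_at E x; rewrite (FE _ _ _ ix) -[a in LHS](dual_trivK ix).
  rewrite lfunE /= /pairing untrivK//; apply: eq_bigr => k _.
  by rewrite [X in _ * X]mxE.
have trivZ (i : tix E) x : tdom i x -> triv i x (Z x) = z i x.
  by move=> ix; apply/rowP => k; rewrite [RHS]mxE -aZ dual_untriv_delta.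
have Zs (i : tix E) : smooth_on A (tdom i) (fun x => triv i x (Z x)).
  have oi := manifold_open (tdom_open i).
  apply: (@smooth_on_ext _ _ _ _ _ _ (z i)) => //.
    by move=> q iq; rewrite trivZ.
  apply: smooth_on_row => // k.
  apply: (@smooth_on_ext _ _ _ _ _ _ (fun x => F (dpoint (dual_untriv i x (delta_mx 0 k))))) => //.
    by move=> q _; rewrite [RHS]mxE.
  exact: smooth_on_frame.
by exists (MkGamma Zs); apply/funext => -[x a]; exact: aZ.
Qed.

(* Homogeneity of [iota Y * F] along the ray through [a] gives [F (t a) = F a] for
   [t != 0]; then [t] tends to 0. *)
Lemma fibre_constant F : (forall Y, fibre_linear (fun p => iota Y p * F p : R^o)) ->
  forall x (a : 'Hom(E x, R^o)), F (dpoint a) = F (dpoint (0 : 'Hom(E x, R^o))).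
Proof.
move=> H x a; have [->//|a0] := eqVneq a 0.
have [e ae] := dual_neq0 a0; have [Y Ye] := section_at e.
symmetry; apply: (@ray_limit F x a) => t t0; apply: (mulfI t0).
pose l : {linear 'Hom(E x, R^o) -> R^o} :=
  HB.pack (fun b : 'Hom(E x, R^o) => iota Y (dpoint b) * F (dpoint b) : R^o)
    (GRing.isLinear.Build _ _ _ _ _ (H Y x)).
have lb b : l b = b e * F (dpoint b) by rewrite /= /iota /= Ye.
have := linearZ_LR l t a; rewrite !lb scale_lfunE ae mul1r => E1.
by apply: etrans E1; rewrite /GRing.scale /= mulr1.
Qed.

End DualSpace.

(** * Skew-symmetry and the Jacobi identity *)

Section Correspondence.
Context {R : realType} {M : manifold R} (E : vbundle M).
Local Notation A := (matlas M).
Local Notation DA := (dual_atlas E).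
Local Notation n := (mdim M).
Local Notation r := (rank E).
Hypothesis r0 : (0 < r)%N.
Implicit Types (x y : M) (X Y Z : Gamma E) (p q : dual_space E).
Implicit Types (f g : smooth_fun A) (L : tensor2 DA) (P : pseudo_lie_algebroid E).

(* Replacing [L] by [- L^T] exchanges the two anchors. *)
Definition opp_tr (L : dual_space E -> 'M[R]_(n + r)) p := - (L p)^T.

Lemma opp_tr_bracket (L : dual_space E -> 'M[R]_(n + r)) F G p :
  bracket DA (opp_tr L) F G p = - bracket DA L G F p.
Proof. by rewrite !bracketE cformN cform_tr. Qed.

Lemma opp_tr_smooth L (c : chart DA) i j : smooth_on DA (dom c)
  (bracket DA (opp_tr L) (fun q => phi c q 0 i) (fun q => phi c q 0 j)).
Proof.
have od := @atlas_open_dom _ _ _ DA c.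
apply: (smooth_on_ext od) (smooth_onN od (@tens_smooth _ _ _ _ L c j i)) => q _.
by rewrite opp_tr_bracket.
Qed.

Definition opp_tensor L : tensor2 DA := Tensor2 (@opp_tr_smooth L).

Lemma sec_scale1 X : sec_scale (cst_fun 1) X = X.
Proof. by apply: Gamma_ext => x /=; rewrite scale1r. Qed.

(** Skewness is the equality of the two tensor fields L and -L^T, and so can be tested on the
    functions [iota X]. *)
Lemma skew_of_pre_lie P L : corresponds P L -> pre_lie P -> skew_tensor L.
Proof.
move=> [H _ _] pP p.
suff e : L p = opp_tensor L p by rewrite {2}e opprK.
apply: (tensor2_eq r0) => X Y [x a] /=; rewrite opp_tr_bracket -!H /iota /=.
by rewrite pP linearN.
Qed.

Lemma pre_lieP P L : corresponds P L -> (pre_lie P <-> skew_tensor L).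
Proof.
move=> cPL; split; first exact: skew_of_pre_lie.
case: cPL => H _ _ sL X Y x; apply: dual_separates => a; rewrite linearN.
have E1 : a (br P X Y x) = bracket DA L (iota X) (iota Y) (dpoint a) by rewrite -H.
have E2 : a (br P Y X x) = bracket DA L (iota Y) (iota X) (dpoint a) by rewrite -H.
have E3 := skew_bracket (iota_fun X) (iota_fun Y) (dpoint a) sL.
exact: (etrans E1 (etrans E3 (congr1 -%R (esym E2)))).
Qed.

Lemma jacobiator_smooth L F G H :
  exists K : smooth_fun DA, forall p, K p = jacobiator L F G H p.
Proof.
have oT := @atlas_openT _ _ _ DA.
pose B := @bracket_fun _ _ _ DA L.
have s := smooth_onD oT (smooth_onD oT (sfun_smooth (B F (B G H)))
  (sfun_smooth (B G (B H F)))) (sfun_smooth (B H (B F G))).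
by exists (SmoothFun s).
Qed.

Lemma lieP P L : corresponds P L -> (lie P <-> poisson_tensor L).
Proof.
move=> cPL; have pP := pre_lieP cPL; have [H _ _] := cPL.
have J X Y Z x (a : 'Hom(E x, R^o)) :
    a (br P X (br P Y Z) x + br P Y (br P Z X) x + br P Z (br P X Y) x) =
    jacobiator L (iota_fun X) (iota_fun Y) (iota_fun Z) (dpoint a).
  rewrite /jacobiator !linearD /=; congr (_ + _ + _).
  - by rewrite -H; exact: (congr1 (fun F => F (dpoint a)) (H X (br P Y Z))).
  - by rewrite -H; exact: (congr1 (fun F => F (dpoint a)) (H Y (br P Z X))).
  - by rewrite -H; exact: (congr1 (fun F => F (dpoint a)) (H Z (br P X Y))).
split=> [[/pP sL jP]|[sL jL]]; split=> //; last 2 first.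
- exact/pP.
- move=> X Y Z x; apply: dual_separates => a; rewrite J linear0; exact: jL.
move=> F G K; have [Jf JE] := jacobiator_smooth L F G K.
have zs : smooth_on DA setT (fun=> 0 : R^o) by apply: smooth_on_cst; exact: atlas_openT.
move=> p; apply: etrans (esym (JE p)) _.
apply: (smooth_dual_eq r0 (F := Jf) (G := SmoothFun zs)) => x a a0 /=; rewrite JE.
(* Linear functions with the differentials of F, G and K at this point. [jacobiator_eq] allows the
   exchange, and on linear functions the Jacobiator is the Jacobi expression of P. *)
have [X gX] := iota_with_grad (grad DA F (dpoint a)) a0.
have [Y gY] := iota_with_grad (grad DA G (dpoint a)) a0.
have [Z gZ] := iota_with_grad (grad DA K (dpoint a)) a0.
apply: etrans (@jacobiator_eq _ _ _ DA L F (iota_fun X) G (iota_fun Y) K (iota_fun Z)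
  _ sL (esym gX) (esym gY) (esym gZ)) _.
by rewrite -J jP linear0.
Qed.

Lemma corresponds_unique P L L' : corresponds P L -> corresponds P L' -> L = L'.
Proof.
move=> [H _ _] [H' _ _]; apply: tensor2_ext; apply: (tensor2_eq r0) => X Y p.
by rewrite -H H'.
Qed.

Lemma bundle_map_ext (F G : vbundle M) (u v : bundle_map F G) :
  (forall x e, u x e = v x e) -> u = v.
Proof.
case: u v => [u us] [v vs] /= uv.
have e : u = v.
  apply: functional_extensionality_dep => x.
  have := uv x; move: (u x) (v x) => [a [[aD] [aZ]]] [b [[bD] [bZ]]] /= ab.
  have e : a = b by apply/funext.
  by subst b; rewrite (Prop_irrelevance aD bD) (Prop_irrelevance aZ bZ).
by subst v; congr BundleMap; exact: Prop_irrelevance.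
Qed.

End Correspondence.

(** * From linear tensors to algebroids *)

Section FromTensor.
Context {R : realType} {M : manifold R} (E : vbundle M).
Local Notation A := (matlas M).
Local Notation DA := (dual_atlas E).
Local Notation n := (mdim M).
Local Notation r := (rank E).
Implicit Types (x y : M) (X Y Z : Gamma E) (p q : dual_space E).
Implicit Types (f g : smooth_fun A) (L : tensor2 DA) (P : pseudo_lie_algebroid E).

Definition dzero x : dual_space E := dpoint (0 : 'Hom(E x, R^o)).

Lemma cform_row_mxl (N : 'M[R]_(n + r)) (u : 'rV[R]_(n + r)) (v : 'rV[R]_n) :
  cform N u (row_mx v 0) = (lsubmx (u *m N) *m v^T) 0 0.
Proof.
rewrite /cform -[u *m N in LHS]hsubmxK tr_row_mx mul_row_col.
by rewrite linear0 mulmx0 addr0.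
Qed.

(** At the zero covector over x the differential of [iota X] is (0, X(x)), so its contraction with L
    is linear in X(x). The base part is the tangent vector whose derivative of f is {iota X, pi^* f}
    at that covector. *)
Definition anchor_mx L x (e : E x) : 'rV[R]_n :=
  lsubmx (row_mx 0 (triv (triv_at E x) x e) *m L (dzero x)).

Lemma anchor_mx_linear L x : linear (@anchor_mx L x).
Proof.
move=> a e e'; rewrite /anchor_mx -linearP; congr lsubmx.
rewrite scalemxAl -mulmxDl scale_row_mx add_row_mx scaler0 addr0; congr (row_mx _ _ *m _).
by rewrite linearP.
Qed.

HB.instance Definition _ L x :=
  GRing.isLinear.Build R (E x) 'rV[R]_n _ (@anchor_mx L x) (@anchor_mx_linear L x).

Lemma deriv_anchor_mx L X f x :
  deriv A f x (anchor_mx L (X x)) = bracket DA L (iota X) (pullback f) (dzero x).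
Proof.
rewrite deriv_grad bracketE grad_pullback; last exact: smooth_fun_at.
rewrite cform_row_mxl grad_iota /anchor_mx.
rewrite (_ : \sum_l _ = 0)// big1// => l _.
by rewrite linear0 mxE scale0r.
Qed.

Lemma smooth_on_dzero (F : smooth_fun DA) : smooth_on A setT (fun x => F (dzero x)).
Proof.
apply: smooth_on_local => x _.
exists (tdom (triv_at E x)), (fun y => F (dpoint (dual_untriv (triv_at E x) y 0))).
split; [exact: manifold_open (tdom_open _)|exact: tdom_at|exact: smooth_on_frame|].
by move=> y _; rewrite linear0.
Qed.

(** On a section constant in i, the m-th component of the anchor in the chart j is the bracket of
    the linear function of that section with the m-th pulled-back coordinate, restricted to the zero
    section. Section and coordinate are first extended from their germs to M. *)
Lemma anchor_mx_smooth L (i : tix E) (j : tix (@tangent R M)) u :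
  smooth_on A (tdom i `&` tdom j)
    (fun x => triv j x (anchor_mx L (untriv i x u))).
Proof.
have oij : open (tdom i `&` tdom j) by apply: openI; exact: tdom_open.
have oi := manifold_open (tdom_open i).
apply: smooth_on_row => [|m]; first exact: manifold_open.
apply: smooth_on_local => x [ix jx].
have [X [V [oV Vx Vi XE]]] := section_extension (tdom_open i) ix
  (@subset_refl _ _) (smooth_on_cst u oi).
have sj : smooth_on A (dom j) (fun y => phi j y 0 m : R^o).
  by apply: smooth_on_entry; [exact: atlas_open_dom|exact: smooth_on_phi].
have [f [U [oU Ux fj]]] := smooth_extension (open_dom j) jx sj.
exists ((V `&` U) `&` dom j), (fun y => bracket DA L (iota X) (pullback f) (dzero y) : R^o).
have oVU : atlas_open A ((V `&` U) `&` dom j).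
  by apply: atlas_openI; [apply: atlas_openI|exact: atlas_open_dom];
    [exact: manifold_open|].
split=> //.
  have sb := smooth_on_dzero (bracket_fun L (iota_fun X) (pullback_fun E f)).
  exact: (smooth_on_sub (@subsetT _ _) sb).
move=> y [[Vy Uy] jy]; rewrite -deriv_anchor_mx.
have -> : X y = untriv i y u by rewrite -(XE y Vy) trivK//; exact: Vi.
rewrite (deriv_chart _ jy (smooth_fun_at f y)); apply: etrans _ (diff_phi m _ jy).
have fj' : \forall w \near phi j y, (f \o psi j) w = ((fun z : M => phi j z 0 m : R^o) \o psi j) w.
  apply: filterS (open_nbhs_nbhs (conj (oU j) _)); last by exists y.
  by move=> w /phi_psi_id[_ Uw] /=; rewrite fj.
have [_ Ed] := near_diff fj' (smooth_at_differentiable jy (smooth_fun_at f y)).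
exact: (congr1 (fun h : 'rV[R]_n -> R^o => h _) (esym Ed)).
Qed.

Definition anchor L : bundle_map E (@tangent R M) :=
  @BundleMap R M E (@tangent R M) (fun x => @anchor_mx L x : {linear _ -> _})
    (@anchor_mx_smooth L).

Lemma opp_tensor_linear L : linear_tensor L -> linear_tensor (opp_tensor L).
Proof.
move=> linL X Y x a b c /=; rewrite !opp_tr_bracket.
have := linL Y X x a b c; rewrite /= => ->.
by rewrite opprD scalerN.
Qed.

Lemma bracket_basic L X f p : linear_tensor L ->
  bracket DA L (iota X) (pullback f) p = deriv A f (projT1 p) (anchor L _ (X (projT1 p))).
Proof.
move=> linL; rewrite [RHS]deriv_anchor_mx; case: p => x a /=.
apply: (@fibre_constant _ _ _ (bracket_fun L (iota_fun X) (pullback_fun E f))) => Y.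
have -> : (fun p => iota Y p * bracket_fun L (iota_fun X) (pullback_fun E f) p : R^o) =
   (fun p => bracket DA L (iota X) (iota (sec_scale f Y)) p -
      pullback f p * bracket DA L (iota X) (iota Y) p : R^o).
  apply/funext => p; rewrite iota_scale.
  rewrite (bracketMr L (iota X) (smooth_fun_at (pullback_fun E f) p) (iota_smooth_at Y p)).
  have alg (u v : R) : v = u + v - u by ring.
  exact: alg.
move=> y b a1 a2 /=; have := linL X (sec_scale f Y) y b a1 a2.
have := linL X Y y b a1 a2; rewrite /pullback /= => -> ->.
by rewrite scalerBr addrACA -opprD mulrDr scalerAr.
Qed.

Lemma bracket_basic_op L X f p : linear_tensor L ->
  bracket DA L (pullback f) (iota X) p =
  - deriv A f (projT1 p) (anchor (opp_tensor L) _ (X (projT1 p))).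
Proof.
by move=> /opp_tensor_linear linL; rewrite -(bracket_basic X f p linL) opp_tr_bracket opprK.
Qed.

Lemma bracket_pullback (r0 : (0 < r)%N) L f g p : linear_tensor L ->
  bracket DA L (pullback f) (pullback g) p = 0.
Proof.
move=> linL.
have zs : smooth_on DA setT (fun=> 0 : R^o) by apply: smooth_on_cst; exact: atlas_openT.
apply: (smooth_dual_eq r0 (F := bracket_fun L (pullback_fun E f) (pullback_fun E g))
  (G := SmoothFun zs)) => x a /dual_neq0[e ae] /=.
have [X Xe] := section_at e.
have H b : g x * bracket DA L (pullback f) (iota X) (dpoint b) +
    b e * bracket DA L (pullback f) (pullback g) (dpoint b) =
    bracket DA L (pullback f) (iota (sec_scale g X)) (dpoint b).
  rewrite iota_scale (bracketMr L (pullback f) (smooth_fun_at (pullback_fun E g) (dpoint b))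
    (iota_smooth_at X (dpoint b))).
  by rewrite /iota /= Xe.
have Bf (b : 'Hom(E x, R^o)) : bracket DA L (pullback f) (iota X) (dpoint b) =
    bracket DA L (pullback f) (iota X) (dzero x).
  exact: (etrans (bracket_basic_op X f (dpoint b) linL)
    (esym (bracket_basic_op X f (dzero x) linL))).
have Bgf (b : 'Hom(E x, R^o)) : bracket DA L (pullback f) (iota (sec_scale g X)) (dpoint b) =
    bracket DA L (pullback f) (iota (sec_scale g X)) (dzero x).
  exact: (etrans (bracket_basic_op (sec_scale g X) f (dpoint b) linL)
    (esym (bracket_basic_op (sec_scale g X) f (dzero x) linL))).
(* The identity [H] at b = a, where b(e) = 1, and at b = 0: the brackets of pi^* f with [iota X] and
   with the linear function of g X are the same at both covectors, so {pi^* f, pi^* g} vanishes at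
   a. *)
have alg (c u k z v : R) : c * u + 1 * k = v -> c * u + 0 * z = v -> k = 0 by lra.
have := H a; rewrite (Bf a) (Bgf a) ae => H1.
have := H 0; rewrite (Bf 0) (Bgf 0) zero_lfunE => H0.
exact: (alg _ _ _ _ _ H1 H0).
Qed.

Lemma section_of_bracket L : linear_tensor L -> forall XY : Gamma E * Gamma E,
  exists Z, iota Z = bracket DA L (iota XY.1) (iota XY.2).
Proof.
move=> linL [X Y].
exact: (@fibre_linear_iota _ _ _ (bracket_fun L (iota_fun X) (iota_fun Y)) (linL X Y)).
Qed.

Lemma corresponds_anchors P L : corresponds P L ->
  (forall X f p, deriv A f (projT1 p) (anchorl P _ (X (projT1 p))) =
     bracket DA L (iota X) (pullback f) p) /\
  (forall X f p, deriv A f (projT1 p) (anchorr P _ (X (projT1 p))) =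
     - bracket DA L (pullback f) (iota X) p).
Proof.
move=> [_ Hl Hr]; split=> X f p.
  exact: (congr1 (fun F => F p) (Hl X f)).
exact: (congr1 (fun F => F p) (Hr X f)).
Qed.

Lemma bundle_map_deriv_ext (u v : bundle_map E (@tangent R M)) :
  (forall X f x, deriv A f x (u x (X x)) = deriv A f x (v x (X x))) -> u = v.
Proof.
move=> H; apply: bundle_map_ext => x e; have [X <-] := section_at e.
apply/rowP => j; have [f [_ gf]] := smooth_fun_with_grad x (delta_mx 0 j) 0.
by have := H X f x; rewrite !deriv_grad gf trmx_delta -!colE [LHS]mxE [RHS]mxE.
Qed.

Lemma pseudo_lie_algebroid_ext P P' : (forall X Y, br P X Y = br P' X Y) ->
  anchorl P = anchorl P' -> anchorr P = anchorr P' -> P = P'.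
Proof.
case: P P' => [b l s b1 b2 b3] [b' l' s' b1' b2' b3'] /= bb ll ss.
have e : b = b' by apply/funext => X; apply/funext => Y.
by subst b' l' s'; congr PseudoLieAlgebroid; exact: Prop_irrelevance.
Qed.

Lemma corresponds_unique_algebroid P P' L : corresponds P L -> corresponds P' L -> P = P'.
Proof.
move=> c c'; have [Hl Hr] := corresponds_anchors c; have [Hl' Hr'] := corresponds_anchors c'.
have [[H _ _] [H' _ _]] := (c, c').
apply: pseudo_lie_algebroid_ext.
- by move=> X Y; apply: iota_inj; rewrite H H'.
- by apply: bundle_map_deriv_ext => X f x; have := Hl X f (dzero x); rewrite /= => ->; rewrite -Hl'.
- by apply: bundle_map_deriv_ext => X f x; have := Hr X f (dzero x); rewrite /= => ->; rewrite -Hr'.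
Qed.

(** The laws are checked on E*, where linear functions separate sections and the laws become
    derivation rules of the bracket. In the expansion for f X and g Y, the term with {pi^* f, pi^*
    g} carries iota X times iota Y, quadratic on the fibres; [bracket_pullback] removes it. *)
Lemma algebroid_of_tensor (r0 : (0 < r)%N) L : linear_tensor L -> exists P, corresponds P L.
Proof.
move=> linL; have [b bE] : exists b : Gamma E -> Gamma E -> Gamma E,
    forall X Y, iota (b X Y) = bracket DA L (iota X) (iota Y).
  exists (fun X Y => sval (cid (section_of_bracket linL (X, Y)))) => X Y.
  by case: cid.
have iota_lin a X Y : iota (sec_add (sec_scale (cst_fun a) X) Y) =
    (fun p => a * iota X p + iota Y p).
  by rewrite iota_add iota_scale.
have sa a X p : smooth_at DA (fun p => a * iota X p : R^o) p.
  by apply: smooth_atM; [exact: smooth_at_cst|exact: iota_smooth_at].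
have bl a X Y Z : b (sec_add (sec_scale (cst_fun a) X) Y) Z =
    sec_add (sec_scale (cst_fun a) (b X Z)) (b Y Z).
  apply: iota_inj; rewrite bE !iota_lin !bE; apply/funext => p.
  rewrite (bracketDl L (iota Z) (sa a X p) (iota_smooth_at Y p)).
  by rewrite (bracket_cstl L a (iota Z) (iota_smooth_at X p)).
have blr a X Y Z : b X (sec_add (sec_scale (cst_fun a) Y) Z) =
    sec_add (sec_scale (cst_fun a) (b X Y)) (b X Z).
  apply: iota_inj; rewrite bE !iota_lin !bE; apply/funext => p.
  rewrite (bracketDr L (iota X) (sa a Y p) (iota_smooth_at Z p)).
  by rewrite (bracket_cstr L a (iota X) (iota_smooth_at Y p)).
have lb f g X Y x : b (sec_scale f X) (sec_scale g Y) x =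
    (f x * deriv A g x (anchor L x (X x))) *: Y x
    - (g x * deriv A f x (anchor (opp_tensor L) x (Y x))) *: X x
    + (f x * g x) *: b X Y x.
  apply: dual_separates => a; pose p := dpoint a.
  have sf := smooth_fun_at (pullback_fun E f) p; have sg := smooth_fun_at (pullback_fun E g) p.
  have sX := iota_smooth_at X p; have sY := iota_smooth_at Y p.
  have -> : a (b (sec_scale f X) (sec_scale g Y) x) =
     bracket DA L (iota (sec_scale f X)) (iota (sec_scale g Y)) p by rewrite -bE.
  rewrite !iota_scale (bracketMl L _ sf sX) (bracketMr L _ sg sY) (bracketMr L _ sg sY).
  rewrite (bracket_basic X g p linL) (bracket_basic_op Y f p linL).
  rewrite (bracket_pullback r0 f g p linL) -bE linearD linearB !linearZ /=.
  rewrite /iota /pullback /= /GRing.scale /=; ring.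
exists (PseudoLieAlgebroid bl blr lb); split=> /= [X Y|X f|X f].
- exact: bE.
- by apply/funext => p; rewrite bracket_basic.
- by apply/funext => p; rewrite bracket_basic_op// opprK.
Qed.

End FromTensor.

(** * From algebroids to linear tensors *)

Section ToTensor.
Context {R : realType} {M : manifold R} (E : vbundle M).
Local Notation A := (matlas M).
Local Notation DA := (dual_atlas E).
Local Notation n := (mdim M).
Local Notation r := (rank E).
Variable P : pseudo_lie_algebroid E.
Implicit Types (x y : M) (X Y Z : Gamma E) (p q : dual_space E).
Implicit Types (f g : smooth_fun A).

Definition sec_eq_at X Y x := exists V : set M, [/\ open V, V x & forall y, V y -> X y = Y y].

(* By the Leibniz rule, multiplying both sections by a cut-off function equal to 1
   near [x] does not change their bracket at [x]. *)
Lemma br_local X X' Y Y' x : sec_eq_at X X' x -> sec_eq_at Y Y' x ->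
  br P X Y x = br P X' Y' x.
Proof.
move=> [V [oV Vx VX]] [V' [oV' V'x VY]].
have [chi [W [K [oW Wx chi1 cK [KV chi0]]]]] :=
  manifold_bump (openI oV oV') (conj Vx V'x).
have dchi : grad A chi x = 0.
  rewrite -(grad_cst A (1 : R^o) x); apply: grad_eq; last exact: smooth_fun_at.
  by exists W; split=> //; exact: manifold_open.
have cut Z Z' : br P (sec_scale chi Z) (sec_scale chi Z') x = br P Z Z' x.
  rewrite br_leibniz !deriv_grad dchi linear0 !mulmx0 mxE !mulr0 !scale0r subr0 add0r.
  by rewrite chi1// mulr1 scale1r.
rewrite -[LHS]cut -[RHS]cut.
have -> : sec_scale chi X = sec_scale chi X'.
  apply: Gamma_ext => y /=; have [/KV[Vy _]|nK] := pselect (K y); first by rewrite VX.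
  by rewrite chi0// !scale0r.
have -> // : sec_scale chi Y = sec_scale chi Y'.
apply: Gamma_ext => y /=; have [/KV[_ Vy]|nK] := pselect (K y); first by rewrite VY.
by rewrite chi0// !scale0r.
Qed.

Lemma sec_sum_smooth m (X : 'I_m -> Gamma E) (i : tix E) :
  smooth_on A (tdom i) (fun x => triv i x (\sum_k X k x)).
Proof.
have oi := manifold_open (tdom_open i).
apply: (smooth_on_ext oi) (smooth_on_sum oi (fun k => sec_smooth (X k) i)) => x _.
by rewrite linear_sum.
Qed.

Definition sec_sum m (X : 'I_m -> Gamma E) : Gamma E := MkGamma (sec_sum_smooth X).

Lemma sec_sumS m (X : 'I_m.+1 -> Gamma E) :
  sec_sum X = sec_add (X ord0) (sec_sum (fun k => X (lift ord0 k))).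
Proof. by apply: Gamma_ext => x /=; rewrite big_ord_recl. Qed.

Lemma additive_sec_sum (V : zmodType) (B : Gamma E -> V) :
  (forall X Y, B (sec_add X Y) = B X + B Y) ->
  forall m (X : 'I_m -> Gamma E), B (sec_sum X) = \sum_k B (X k).
Proof.
move=> BD; elim=> [|m IH] X; last by rewrite sec_sumS BD IH big_ord_recl.
(* The empty sum S is the zero section, and S + S = S gives B(S) = 0 from additivity alone. *)
rewrite big_ord0; apply: (addrI (B (sec_sum X))); rewrite -BD addr0; congr B.
by apply: Gamma_ext => x /=; rewrite big_ord0 addr0.
Qed.

Lemma br_addl X Y Z : br P (sec_add X Y) Z = sec_add (br P X Z) (br P Y Z).
Proof. by rewrite -{1}[X]sec_scale1 br_linearl sec_scale1. Qed.

Lemma br_addr X Y Z : br P X (sec_add Y Z) = sec_add (br P X Y) (br P X Z).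
Proof. by rewrite -{1}[Y]sec_scale1 br_linearr sec_scale1. Qed.

Lemma br_sum m (X Y : 'I_m -> Gamma E) x :
  br P (sec_sum X) (sec_sum Y) x = \sum_k \sum_l br P (X k) (Y l) x.
Proof.
rewrite (additive_sec_sum (B := fun Z => br P Z (sec_sum Y) x)); last first.
  by move=> Z Z'; rewrite br_addl.
apply: eq_bigr => k _.
by rewrite (additive_sec_sum (B := fun Z => br P (X k) Z x)) // => Z Z'; rewrite br_addr.
Qed.

Lemma frame_exists x (k : 'I_r) : exists X, exists V : set M,
  [/\ open V, V x, V `<=` tdom (triv_at E x) &
    forall y, V y -> triv (triv_at E x) y (X y) = delta_mx 0 k].
Proof.
apply: (section_extension (h := fun=> delta_mx 0 k) (tdom_open (triv_at E x))) => //.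
  exact: tdom_at.
by apply: smooth_on_cst; exact: manifold_open (tdom_open _).
Qed.

(** Global sections agreeing near x with the frame of the preferred trivialization. They are chosen
    separately for each x; by locality only their germs at x enter a bracket at x. *)
Definition frame x k : Gamma E := sval (cid (frame_exists x k)).

Lemma frameE x k : frame x k x = untriv (triv_at E x) x (delta_mx 0 k).
Proof.
rewrite /frame; case: cid => X [V [_ Vx Vi VX]] /=.
by rewrite -(VX x Vx) trivK//; exact: Vi.
Qed.

Definition coords X x k y : R^o := triv (triv_at E x) y (X y) 0 k.

(** Near x the section becomes a sum of products of global functions and global sections, the form
    to which the Leibniz rule of [br] applies. *)
Lemma coords_extension X x : exists f : 'I_r -> smooth_fun A,
  (forall k, grad A (f k) x = grad A (coords X x k) x /\ f k x = coords X x k x) /\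
  sec_eq_at X (sec_sum (fun k => sec_scale (f k) (frame x k))) x.
Proof.
pose i := triv_at E x; have ix : tdom i x by exact: tdom_at.
have oi := manifold_open (tdom_open i).
have ext k : exists f : smooth_fun A, eq_at A f (coords X x k) x.
  apply: smooth_extension (tdom_open i) ix _.
  by apply: smooth_on_entry; [exact: oi|exact: sec_smooth].
pose f k := sval (cid (ext k)); have fE k : eq_at A (f k) (coords X x k) x.
  by rewrite /f; case: cid.
exists f; split.
  move=> k; split; first exact: grad_eq (fE k) (smooth_fun_at _ _).
  by have [U [_ Ux ->]] := fE k.
have loc k : exists V : set M, [/\ open V, V x, V `<=` tdom i &
    forall y, V y -> f k y *: frame x k y = coords X x k y *: untriv i y (delta_mx 0 k)].
  have [U [oU Ux fU]] := fE k.
  rewrite /frame; case: cid => Y [V [oV Vx Vi VY]] /=.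
  exists (V `&` U); split=> //; first by apply: openI => //; apply/open_atlasE.
    by move=> y [/Vi].
  move=> y [Vy Uy]; rewrite fU//; congr (_ *: _).
  by rewrite -(VY y Vy) trivK//; exact: Vi.
pose W k := sval (cid (loc k)).
have WE k : [/\ open (W k), W k x, W k `<=` tdom i &
    forall y, W k y -> f k y *: frame x k y = coords X x k y *: untriv i y (delta_mx 0 k)].
  by rewrite /W; case: cid.
have oW : \forall y \near x, forall k, W k y.
  apply: filter_forall => k; have [oWk Wx _ _] := WE k.
  exact: open_nbhs_nbhs.
have oix : \forall y \near x, tdom i y by apply: open_nbhs_nbhs; split=> //; exact: tdom_open.
have : nbhs x [set y | tdom i y /\ forall k, W k y] by exact: filterI.
rewrite nbhsE; case=> V [oV Vx] VW; exists V; split=> // y /VW[iy Wy] /=.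
rewrite -[LHS](trivK iy) untriv_delta; apply: eq_bigr => k _.
by have [_ _ _ ->] := WE k.
Qed.

Lemma deriv_sum (f : M -> R^o) x m (c : 'I_m -> R) (v : 'I_m -> 'rV[R]_n) :
  deriv A f x (\sum_k c k *: v k) = \sum_k c k * deriv A f x (v k).
Proof.
rewrite deriv_grad mulmx_suml summxE; apply: eq_bigr => k _.
by rewrite deriv_grad -scalemxAl [LHS]mxE.
Qed.

Lemma triv_sum (i : tix E) x (e : E x) : tdom i x ->
  e = \sum_k triv i x e 0 k *: untriv i x (delta_mx 0 k).
Proof. by move=> ix; rewrite -untriv_delta trivK. Qed.

(** Locality replaces X and Y by sums over the frame, the Leibniz rule expands their bracket, and
    linearity of the anchors on the fibre recombines the terms at X(x) and Y(x). Only values and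
    first derivatives of the components at x remain. *)
Lemma br_frame X Y x (i := triv_at E x) : br P X Y x =
  \sum_l deriv A (coords Y x l) x (anchorl P x (X x)) *: untriv i x (delta_mx 0 l)
  - \sum_k deriv A (coords X x k) x (anchorr P x (Y x)) *: untriv i x (delta_mx 0 k)
  + \sum_k \sum_l (coords X x k x * coords Y x l x) *: br P (frame x k) (frame x l) x.
Proof.
have ix : tdom i x by exact: tdom_at.
have [f [fE fX]] := coords_extension X x; have [g [gE gY]] := coords_extension Y x.
rewrite (br_local fX gY) br_sum.
have lE k l : br P (sec_scale (f k) (frame x k)) (sec_scale (g l) (frame x l)) x =
    (coords X x k x * deriv A (coords Y x l) x (anchorl P x (untriv i x (delta_mx 0 k))))
      *: untriv i x (delta_mx 0 l)
    - (coords Y x l x * deriv A (coords X x k) x (anchorr P x (untriv i x (delta_mx 0 l))))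
      *: untriv i x (delta_mx 0 k)
    + (coords X x k x * coords Y x l x) *: br P (frame x k) (frame x l) x.
  have [gf fx] := fE k; have [gg gx] := gE l.
  by rewrite br_leibniz !deriv_grad gf gg fx gx !frameE.
under eq_bigr => k _ do (under eq_bigr => l _ do rewrite lE); rewrite -/i.
have anchor_sum (u : bundle_map E (@tangent R M)) Z : u x (Z x) =
    \sum_k coords Z x k x *: u x (untriv i x (delta_mx 0 k)).
  rewrite [in LHS](triv_sum (Z x) ix) linear_sum; apply: eq_bigr => k _.
  by rewrite linearZ.
under eq_bigr => k _ do rewrite big_split sumrB.
rewrite big_split sumrB /=; congr (_ - _ + _).
  rewrite exchange_big; apply: eq_bigr => l _ /=.
  by rewrite -scaler_suml; congr (_ *: _); rewrite anchor_sum; exact: (esym (deriv_sum _ _ _ _)).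
apply: eq_bigr => k _ /=.
by rewrite -scaler_suml; congr (_ *: _); rewrite anchor_sum; exact: (esym (deriv_sum _ _ _ _)).
Qed.

(** As the frames are chosen point by point, smoothness cannot be read off the entries; it is
    obtained from brackets of functions instead. *)
Definition algebroid_tensor p : 'M[R]_(n + r) :=
  let x := projT1 p in let i := triv_at E x in
  block_mx 0 (\matrix_(j, k) - (anchorr P x (untriv i x (delta_mx 0 k)) : 'rV[R]_n) 0 j)
    (\matrix_(k, j) (anchorl P x (untriv i x (delta_mx 0 k)) : 'rV[R]_n) 0 j)
    (\matrix_(k, l) (projT2 p : 'Hom(E x, R^o)) (br P (frame x k) (frame x l) x)).

Lemma cform_block (B : 'M[R]_(n, r)) (C : 'M[R]_(r, n)) (D : 'M[R]_r)
    (s s' : 'rV[R]_n) (t t' : 'rV[R]_r) :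
  cform (block_mx 0 B C D) (row_mx s t) (row_mx s' t') =
  (t *m C *m s'^T) 0 0 + (s *m B *m t'^T) 0 0 + (t *m D *m t'^T) 0 0.
Proof.
rewrite /cform mul_row_block mulmx0 add0r tr_row_mx mul_row_col [LHS]mxE mulmxDl.
by rewrite [X in _ + X]mxE addrA.
Qed.

Lemma anchor_row (u : bundle_map E (@tangent R M)) X x (i := triv_at E x) :
  triv i x (X x) *m \matrix_(k, j) (u x (untriv i x (delta_mx 0 k)) : 'rV[R]_n) 0 j
  = u x (X x).
Proof.
rewrite [in RHS](triv_sum (X x) (tdom_at E x)) linear_sum; apply/rowP => j.
rewrite mxE summxE; apply: eq_bigr => k _.
by rewrite [X in _ * X]mxE linearZ [RHS]mxE.
Qed.

Lemma anchorr_tr x (i := triv_at E x) :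
  \matrix_(j, k) - (anchorr P x (untriv i x (delta_mx 0 k)) : 'rV[R]_n) 0 j
  = - (\matrix_(k, j) (anchorr P x (untriv i x (delta_mx 0 k)) : 'rV[R]_n) 0 j)^T.
Proof. by apply/matrixP => j k; rewrite !mxE. Qed.

Lemma algebroid_bracket_pullback f g p :
  bracket DA algebroid_tensor (pullback f) (pullback g) p = 0.
Proof.
rewrite bracketE !grad_pullback; try exact: smooth_fun_at.
by rewrite cform_block !mul0mx linear0 mulmx0 !mxE !addr0.
Qed.

Lemma algebroid_bracketl X f p : bracket DA algebroid_tensor (iota X) (pullback f) p =
  deriv A f (projT1 p) (anchorl P _ (X (projT1 p))).
Proof.
case: p => x a; rewrite bracketE grad_pullback; last exact: smooth_fun_at.
rewrite (grad_iota X a) cform_block linear0 !mulmx0 [X in _ + X + _]mxE [X in _ + X]mxE.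
by rewrite !addr0 anchor_row deriv_grad.
Qed.

Lemma algebroid_bracketr X f p : bracket DA algebroid_tensor (pullback f) (iota X) p =
  - deriv A f (projT1 p) (anchorr P _ (X (projT1 p))).
Proof.
case: p => x a; rewrite bracketE grad_pullback; last exact: smooth_fun_at.
rewrite (grad_iota X a) cform_block !mul0mx [X in X + _ + _]mxE [X in _ + X]mxE.
rewrite add0r addr0 anchorr_tr mulmxN mulNmx [LHS]mxE; congr (- _).
rewrite deriv_grad -anchor_row.
set N := \matrix_(k, j) _; set s := grad _ _ _; set t := triv _ _ _.
have -> : t *m N *m s^T = (s *m N^T *m t^T)^T by rewrite !trmx_mul !trmxK mulmxA.
by rewrite [RHS]mxE.
Qed.

(** The three nonzero blocks contribute, in the order of [cform_block], the three sums of
    [br_frame]: left anchor, right anchor, brackets of the frame. *)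
Lemma algebroid_bracket X Y :
  bracket DA algebroid_tensor (iota X) (iota Y) = iota (br P X Y).
Proof.
apply/funext => -[x a]; rewrite bracketE !(grad_iota _ a) cform_block /=.
pose i := triv_at E x; rewrite -/i.
have aE k : dual_triv i a 0 k = a (untriv i x (delta_mx 0 k)) by rewrite mxE.
have aD (u v w : E x) : a (u - v + w) = a u - a v + a w by rewrite linearD linearB.
rewrite [RHS]/iota /= br_frame [RHS]aD; congr (_ + _ + _).
- rewrite anchor_row linear_sum mulmx_sumr summxE [RHS]linear_sum.
  apply: eq_bigr => l _.
  rewrite linearZ -scalemxAr [LHS]mxE [RHS]linearZ deriv_grad aE; exact: mulrC.
- rewrite anchorr_tr mulmxN mulNmx [LHS]mxE; congr (- _).
  rewrite !mulmx_suml summxE [RHS]linear_sum; apply: eq_bigr => k _.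
  rewrite -!scalemxAl [LHS]mxE [RHS]linearZ deriv_grad aE -anchor_row -/i mulrC.
  set N := \matrix_(k, j) _; set s := grad _ _ _; set t := triv _ _ _.
  have -> : t *m N *m s^T = (s *m N^T *m t^T)^T by rewrite !trmx_mul !trmxK mulmxA.
  by rewrite [X in _ = X *: _]mxE.
- rewrite mxE; under eq_bigr => l _ do rewrite mxE big_distrl.
  rewrite exchange_big; rewrite [RHS]linear_sum; apply: eq_bigr => k _ /=.
  rewrite [RHS]linear_sum; apply: eq_bigr => l _.
  rewrite [RHS]linearZ [X in _ * X * _]mxE [X in _ * X]mxE /coords.
  exact: mulrAC.
Qed.

Lemma vector_field_smooth (u : bundle_map E (@tangent R M)) X f :
  smooth_on A setT (fun y => deriv A f y (u y (X y))).
Proof.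
apply: smooth_on_local => x _.
pose i := triv_at E x; pose c := chart_at A x.
have oic : atlas_open A (@tdom _ _ E i `&` dom c).
  by apply: manifold_open; apply: openI; [exact: tdom_open|exact: open_dom].
pose V k y : 'rV[R]_n := triv (c : tix (@tangent R M)) y (u y (untriv i y (delta_mx 0 k))).
pose D j y : R^o := 'd (f \o psi c) (phi c y) (delta_mx 0 j).
(* The section is expanded in the frame of i, since smoothness of a bundle map is stated on constant
   vectors; the derivative is then taken in the fixed chart c. *)
exists (tdom i `&` dom c), (fun y => \sum_k \sum_j (triv i y (X y) 0 k * V k y 0 j) * D j y : R^o).
split=> //.
- by split; [exact: tdom_at|exact: dom_chart_at].
- apply: smooth_on_sum => // k; apply: smooth_on_sum => // j; apply: smooth_onM => //.
    apply: smooth_onM => //; apply: smooth_on_entry => //.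
      by apply: smooth_on_sub (sec_smooth X i) => y [].
    exact: (@bmap_smooth _ _ _ _ u i c (delta_mx 0 k)).
  have sD : smooth_on A (dom c) (D j).
    apply: (smooth_on_comp_phi (W := phi c @` (dom c `&` setT))
      (B := fun w => 'd (f \o psi c) w (delta_mx 0 j))).
      by move=> y cy; exists y.
    by move=> k'; have [_ ] := sfun_smooth f c k'.+1; exact.
  by apply: smooth_on_sub sD => y [].
- move=> y [iy cy]; rewrite (deriv_chart _ cy (smooth_fun_at f y)).
  have -> : 'd (phi c \o psi (chart_at A y)) (phi (chart_at A y) y) (u y (X y)) =
      \sum_k triv i y (X y) 0 k *: V k y.
    rewrite [X y in LHS](triv_sum (X y) iy) linear_sum linear_sum.
    by apply: eq_bigr => k _; rewrite linearZ linearZ.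
  rewrite linear_sum; apply: eq_bigr => k _; rewrite linearZ /= diff_row scaler_sumr.
  by apply: eq_bigr => j _; exact: esym (mulrA _ _ _).
Qed.

End ToTensor.

(** * Smoothness of the tensor of an algebroid *)

Section ToTensorSmooth.
Context {R : realType} {M : manifold R} (E : vbundle M).
Local Notation A := (matlas M).
Local Notation DA := (dual_atlas E).
Local Notation n := (mdim M).
Local Notation r := (rank E).
Variable P : pseudo_lie_algebroid E.

(** The functions whose brackets are known globally. Near any point of a chart each coordinate of E*
    agrees with one of them: a base coordinate with a pull-back, a fibre coordinate with [iota] of a
    section constant in the trivialization. *)
Definition basic_or_linear (F : smooth_fun DA) : Prop :=
  (exists f, F = pullback_fun E f) \/ (exists X, F = iota_fun X).

Lemma coordinate_extension (c : chart DA) (k : 'I_(n + r)) p : dom c p ->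
  exists F, basic_or_linear F /\ eq_at DA F (fun q => phi c q 0 k) p.
Proof.
case: c => c i [/= cp ip]; case: (split_ordP k) => j ->.
  have sj : smooth_on A (dom c) (fun y => phi c y 0 j : R^o).
    by apply: smooth_on_entry; [exact: atlas_open_dom|exact: smooth_on_phi].
  have [f [U [oU Up fU]]] := smooth_extension (open_dom c) cp sj.
  exists (pullback_fun E f); split; first by left; exists f.
  exists (@projT1 _ _ @^-1` U); split=> //.
    by apply: dual_atlas_open; apply/open_atlasE.
  by move=> q Uq /=; rewrite /total_phi row_mxEl /pullback fU.
have [X [V [oV Vx Vi XV]]] :=
  @section_extension _ _ E i _ _ _ (tdom_open i) ip (@subset_refl _ _)
    (smooth_on_cst (delta_mx 0 j : 'rV[R]_r) (manifold_open (tdom_open i))).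
exists (iota_fun X); split; first by right; exists X.
exists (@projT1 _ _ @^-1` V); split=> //; first exact: dual_atlas_open.
move=> q Vq; rewrite /= (iotaE X (Vi _ Vq)) XV// (bigD1 j)//= big1 => [|l lj].
  by rewrite /total_phi row_mxEr [X in _ * X + _]mxE !eqxx mulr1 addr0.
by rewrite [X in _ * X]mxE (negbTE lj) andbF mulr0.
Qed.

Lemma algebroid_tensor_smooth_fun F G : basic_or_linear F -> basic_or_linear G ->
  smooth_on DA setT (bracket DA (algebroid_tensor P) F G).
Proof.
have oT := @atlas_openT _ _ _ DA.
move=> [[f ->]|[X ->]] [[g ->]|[Y ->]] /=.
- apply: (smooth_on_ext oT) (smooth_on_cst (0 : R^o) oT) => q _.
  by rewrite algebroid_bracket_pullback.
- apply: (smooth_on_ext oT) (smooth_onN oT (smooth_on_pullback openT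
    (vector_field_smooth (anchorr P) Y f))) => q _.
  by rewrite algebroid_bracketr.
- apply: (smooth_on_ext oT) (smooth_on_pullback openT
    (vector_field_smooth (anchorl P) X g)) => q _.
  by rewrite algebroid_bracketl.
- rewrite algebroid_bracket; exact: iota_smooth.
Qed.

(** The bracket sees only differentials, so near p both coordinates may be replaced by such global
    functions. *)
Lemma algebroid_tensor_smooth (c : chart DA) j k : smooth_on DA (dom c)
  (bracket DA (algebroid_tensor P) (fun q => phi c q 0 j) (fun q => phi c q 0 k)).
Proof.
apply: smooth_on_local => p cp.
have [F [bF [U [oU Up FU]]]] := coordinate_extension j cp.
have [G [bG [V [oV Vp GV]]]] := coordinate_extension k cp.
exists (U `&` V), (bracket DA (algebroid_tensor P) F G); split.
- exact: atlas_openI.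
- by split.
- exact: (smooth_on_sub (@subsetT _ _) (algebroid_tensor_smooth_fun bF bG)).
- move=> q [Uq Vq]; apply: bracket_eq; apply: grad_eq; try exact: smooth_fun_at.
    by exists U.
  by exists V.
Qed.

Definition tensor_of_algebroid : tensor2 DA := Tensor2 algebroid_tensor_smooth.

Lemma tensor_of_algebroid_corresponds : corresponds P tensor_of_algebroid.
Proof.
split=> [X Y|X f|X f].
- by rewrite /= algebroid_bracket.
- by apply/funext => p; rewrite /= algebroid_bracketl.
- by apply/funext => p; rewrite /= algebroid_bracketr opprK.
Qed.

Lemma tensor_of_algebroid_linear : linear_tensor tensor_of_algebroid.
Proof.
by move=> X Y x a b b'; rewrite /= algebroid_bracket /iota /= add_lfunE scale_lfunE.
Qed.

End ToTensorSmooth.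

Theorem theorem2p1 (R : realType) (M : manifold R) (E : vbundle M)
    (rank_gt0 : (0 < rank E)%N) :
  (forall A : pseudo_lie_algebroid E,
     exists! L : tensor2 (dual_atlas E), linear_tensor L /\ corresponds A L) /\
  (forall L : tensor2 (dual_atlas E), linear_tensor L ->
     exists! A : pseudo_lie_algebroid E, corresponds A L) /\
  (forall (A : pseudo_lie_algebroid E) (L : tensor2 (dual_atlas E)),
     linear_tensor L -> corresponds A L ->
     (pre_lie A <-> skew_tensor L) /\ (lie A <-> poisson_tensor L)).
Proof.
split; [move=> P|split; [move=> L linL|move=> P L _ cPL]].
- exists (tensor_of_algebroid P); split.
    split; first exact: tensor_of_algebroid_linear.
    exact: tensor_of_algebroid_corresponds.
  move=> L [_ cPL]; apply: (corresponds_unique rank_gt0) cPL.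
  exact: tensor_of_algebroid_corresponds.
- have [P cP] := algebroid_of_tensor rank_gt0 linL; exists P; split=> // P'.
  exact: corresponds_unique_algebroid.
- split; first exact: (pre_lieP rank_gt0 cPL).
  exact: (lieP rank_gt0 cPL).
Qed.
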